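(* Let $D=\{d_1,\ldots,d_n\}$ be an instance of 2-Visits, let $A$ be the discretized sequence of $D$, and let $p$ be the maximum, over all clusters of $A$, of the number of distinct deadlines corresponding to that cluster. Then in $O(n^{p+1}p)$ time one can construct, for each cluster of $A$, an instance of Exact Matching with $O(n^{p+1}p)$ vertices and edges, such that $D$ is a yes-instance of 2-Visits if and only if every one of these Exact Matching instances is a yes-instance.
   Context: 2-Visits: given a multiset of positive integers (deadlines) $D=\{d_1,\ldots,d_n\}$, decide whether there is a sequence of length $2n$ with entries in $[n]$, containing each $i\in[n]$ exactly twice, such that the first occurrence of $i$ is within the first $d_i$ positions and the second occurrence of $i$ is at most $d_i$ positions after the first. Deadlines are indexed so that $d_1\leq\cdots\leq d_n$. Discretized sequence: $A=\langle a_1,\ldots,a_n\rangle$ with $a_n=d_n$ and $a_i=\min\{a_{i+1}-1,\ d_i\}$ for $i<n$. A cluster of $A$ is a maximal contiguous subsequence $\langle a_i,\ldots,a_j\rangle$ of consecutive integers (i.e., $a_{l+1}=a_l+1$ for $i\leq l<j$); the deadlines $d_i,\ldots,d_j$ are said to correspond to this cluster. Exact Matching: given a graph $G$, a subset of red edges, and a positive integer $k$, decide whether $G$ has a perfect matching containing exactly $k$ red edges. *)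

(* Defs.v *)
From mathcomp Require Import all_boot all_order all_algebra.

Set Implicit Arguments.
Unset Strict Implicit.
Unset Printing Implicit Defensive.

(* A multiset of deadlines is a list, in arbitrary order. *)
Definition is_instance (D : seq nat) : bool := (0 < size D) && all (leq 1) D.

(* Positions in a schedule are counted from 1.  [gap s i] is the distance from
   the first to the second occurrence of [i] in [s]. *)
Definition first_pos (T : eqType) (s : seq T) (i : T) : nat := (index i s).+1.

Definition gap (T : eqType) (s : seq T) (i : T) : nat :=
  (index i (drop (first_pos s i) s)).+1.

Definition two_visits (D : seq nat) : Prop :=
  exists s : seq 'I_(size D),
    size s = 2 * size D /\
    forall i : 'I_(size D),
      [/\ count_mem i s = 2,
          first_pos s i <= nth 0 D i
        & gap s i <= nth 0 D i].

(* Indices run from 0 to n - 1: entry [i] below is the entry of index i + 1 of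
   the usual 1-based notation. *)
Definition sorted_deadlines (D : seq nat) : seq nat := sort leq D.

(* The values can drop to 0 or below, hence integers and not naturals. *)
Fixpoint discretize (d : seq nat) : seq int :=
  match d with
  | [::] => [::]
  | x :: d' =>
    match discretize d' with
    | [::] => [:: Posz x]
    | (b :: _) as A => Num.min (b - 1)%R (Posz x) :: A
    end
  end.

Definition discretized (D : seq nat) : seq int :=
  discretize (sorted_deadlines D).

(* A contiguous subsequence a_i, ..., a_j is given by the pair (i, j). *)
Definition consecutive (A : seq int) (C : nat * nat) : bool :=
  [&& C.1 <= C.2, C.2 < size A
    & all (fun l => nth 0 A l.+1 == nth 0 A l + 1)%R (iota C.1 (C.2 - C.1))].

Definition index_pairs (n : nat) : seq (nat * nat) :=
  [seq (i, j) | i <- iota 0 n, j <- iota 0 n].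

Definition is_cluster (A : seq int) (C : nat * nat) : bool :=
  consecutive A C &&
  all (fun C' => [&& consecutive A C', C'.1 <= C.1 & C.2 <= C'.2] ==> (C' == C))
      (index_pairs (size A)).

Definition clusters (D : seq nat) : seq (nat * nat) :=
  [seq C <- index_pairs (size D) | is_cluster (discretized D) C].

Definition cluster_deadlines (D : seq nat) (C : nat * nat) : seq nat :=
  drop C.1 (take C.2.+1 (sorted_deadlines D)).

Definition max_distinct (D : seq nat) : nat :=
  \max_(C <- clusters D) size (undup (cluster_deadlines D C)).

Record em_instance := EMInstance {
  em_nv : nat;
  em_edges : {set {set 'I_em_nv}};
  em_red : {set {set 'I_em_nv}};
  em_k : nat;
  em_edges_card2 : [forall e in em_edges, #|e| == 2];
  em_red_sub : em_red \subset em_edges;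
  em_k_gt0 : 0 < em_k
}.

(* A set of edges is a perfect matching iff it partitions the vertex set. *)
Definition exact_matching (I : em_instance) : Prop :=
  exists M : {set {set 'I_(em_nv I)}},
    [/\ M \subset em_edges I,
        partition M [set: 'I_(em_nv I)]
      & #|M :&: em_red I| = em_k I].

(* The word [w] lists the instance [I]: number of vertices, number of edges,
   k, and then each edge exactly once, in some order, as three numbers: its
   two endpoints and its red flag.  The format is self-delimiting, so a
   concatenation of such words can be read back in a unique way. *)
Definition em_code (I : em_instance) (w : seq nat) : Prop :=
  exists es : seq ('I_(em_nv I) * 'I_(em_nv I)),
    let edge e := [set e.1; e.2] in
    [/\ uniq [seq edge e | e <- es],
        [seq edge e | e <- es] =i em_edges I
      & w = [:: em_nv I, size es, em_k I &
               flatten [seq [:: val e.1; val e.2; nat_of_bool (edge e \in em_red I)]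
                       | e <- es]]].

(* Random access machine with the uniform cost measure, as structured programs
   over finitely many registers ([Var x]) and a memory
   with indirect addressing ([Read], [Write]); all cells hold naturals.
   Subtraction is truncated and the comparisons return 0 or 1.  There is
   deliberately no multiplication or shift: with addition as the only
   operation that increases numbers, unit cost is a reasonable cost measure. *)
Inductive expr :=
| Cst of nat
| Var of nat
| Read of expr
| Add of expr & expr
| Sub of expr & expr
| Leq of expr & expr
| Eqn of expr & expr.

Inductive cmd :=
| Skip
| Assign of nat & expr
| Write of expr & expr
| Seq of cmd & cmd
| If of expr & cmd & cmd
| While of expr & cmd.

Record state := State { regs : nat -> nat; mem : nat -> nat }.

Fixpoint eval (s : state) (e : expr) : nat :=
  match e with
  | Cst k => k
  | Var x => regs s x
  | Read e1 => mem s (eval s e1)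
  | Add e1 e2 => eval s e1 + eval s e2
  | Sub e1 e2 => eval s e1 - eval s e2
  | Leq e1 e2 => nat_of_bool (eval s e1 <= eval s e2)
  | Eqn e1 e2 => nat_of_bool (eval s e1 == eval s e2)
  end.

Fixpoint cost (e : expr) : nat :=
  match e with
  | Cst _ | Var _ => 1
  | Read e1 => (cost e1).+1
  | Add e1 e2 | Sub e1 e2 | Leq e1 e2 | Eqn e1 e2 => (cost e1 + cost e2).+1
  end.

Definition set_reg (s : state) (x v : nat) : state :=
  State (fun y => if y == x then v else regs s y) (mem s).

Definition set_mem (s : state) (a v : nat) : state :=
  State (regs s) (fun b => if b == a then v else mem s b).

(* [exec c s t s']: started in [s], program [c] halts in [s'] after time [t];
   a test is true when its value is nonzero. *)
Inductive exec : cmd -> state -> nat -> state -> Prop :=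
| exec_skip s : exec Skip s 1 s
| exec_assign s x e : exec (Assign x e) s (cost e).+1 (set_reg s x (eval s e))
| exec_store s a e :
    exec (Write a e) s (cost a + cost e).+1 (set_mem s (eval s a) (eval s e))
| exec_seq s s1 s2 c1 c2 t1 t2 :
    exec c1 s t1 s1 -> exec c2 s1 t2 s2 -> exec (Seq c1 c2) s (t1 + t2) s2
| exec_if_true s s1 e c1 c2 t :
    eval s e != 0 -> exec c1 s t s1 -> exec (If e c1 c2) s (cost e + t).+1 s1
| exec_if_false s s1 e c1 c2 t :
    eval s e = 0 -> exec c2 s t s1 -> exec (If e c1 c2) s (cost e + t).+1 s1
| exec_while_stop s e c :
    eval s e = 0 -> exec (While e c) s (cost e).+1 s
| exec_while_step s s1 s2 e c t1 t2 :
    eval s e != 0 -> exec c s t1 s1 -> exec (While e c) s1 t2 s2 ->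
    exec (While e c) s (cost e + t1 + t2).+1 s2.

(* The input word is in memory from address 0 on and its length is in register
   0; everything else is 0.  On halting, registers 0 and 1 hold the start
   address and the length of the output word in memory. *)
Definition input (w : seq nat) : state :=
  State (fun x => if x == 0 then size w else 0) (nth 0 w).

Definition output (s : state) : seq nat :=
  [seq mem s (regs s 0 + i) | i <- iota 0 (regs s 1)].

Definition computes_in (P : cmd) (w : seq nat) (t : nat) (w' : seq nat) : Prop :=
  exists t' s, [/\ exec P (input w) t' s, t' <= t & output s = w'].

(* Main.v *)
(* Call a position taken if it is an entry of the discretized sequence A. A
   schedule may be stretched to one with idle positions, and then, moving visits
   to later positions as long as possible, one may assume that the first visits
   occupy exactly A. The second visits can then use the free positions in
   increasing order. Feasibility becomes a matching problem: assign the
   deadlines bijectively to the slots a of A with a <= delta, and the ranks of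
   the free positions bijectively to the slots, such that a free position of
   rank r is at most a + delta. The slots of a cluster receive the deadlines of
   that cluster, and since a + delta increases from cluster to cluster, an
   exchange of ranks shows that the clusters can be treated independently.

   For a cluster with m slots, the Exact Matching instance has vertices
   0, ..., m - 1 for the slots, m, ..., 2m - 1 for the ranks, and for each slot u
   and each distinct deadline number q of the cluster a path of 2 (n + 1)^q new
   vertices from u to all ranks that are compatible with giving u this
   deadline. Matching u into the path uses (n + 1)^q red edges, not doing so uses
   none. The number of red edges therefore determines, in base n + 1, how often
   each deadline is used. *)
Require Import Defs.
From Stdlib Require Import FunctionalExtensionality.
From mathcomp Require Import all_boot all_order all_algebra.
From mathcomp Require Import zify.

Set Implicit Arguments.
Unset Strict Implicit.
Unset Printing Implicit Defensive.

(** * Timed execution *)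

(** The red count is the only global constraint that Exact Matching offers, so one number has to fix
    the whole multiset of deadlines given to the slots. A deadline is used at most m <= n times,
    hence base n + 1 has no carries, and asking for the sum of the weights of all deadlines of the
    cluster forces every multiplicity. The price is bounded: the largest weight (n + 1)^(p - 1) is
    at most 2 n^p, so m slots and at most p classes cost O(m n^p p), and the cluster sizes add up to
    n. First visits can be pushed onto A because no order between the two visits of a task has to be
    maintained: a second visit that occupies the wanted slot trades places with the first visit that
    moves there. All values of A are stored with n added. A slot whose stored value is at most n
    would lie before position 1; it has no compatible rank, so its cluster yields a no-instance. In
    a cluster starting at index i0, ranks are counted after the first i0 free positions, which are
    left to the i0 earlier slots. *)

Definition runs (c : cmd) (s : state) (T : nat) (s' : state) : Prop :=
  exists2 t, exec c s t s' & t <= T.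

(* All registers beyond the length of [v] are 0. *)
Definition St (v : seq nat) (M : nat -> nat) : state := State (nth 0 v) M.

Lemma runs_weaken c s T T' s' : T <= T' -> runs c s T s' -> runs c s T' s'.
Proof. by move=> le [t et lt]; exists t => //; apply: leq_trans le. Qed.

Lemma runs_skip s : runs Skip s 1 s.
Proof. by exists 1 => //; constructor. Qed.

Lemma runs_seq c1 c2 s s1 s2 t1 t2 :
  runs c1 s t1 s1 -> runs c2 s1 t2 s2 -> runs (Seq c1 c2) s (t1 + t2) s2.
Proof.
move=> [a ea la] [b eb lb]; exists (a + b); last exact: leq_add.
exact: exec_seq ea eb.
Qed.

Lemma runs_assign x e v v' M :
  set_nth 0 v x (eval (St v M) e) = v' ->
  runs (Assign x e) (St v M) (cost e).+1 (St v' M).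
Proof.
move=> <-; exists (cost e).+1 => //.
have -> : St (set_nth 0 v x (eval (St v M) e)) M
          = set_reg (St v M) x (eval (St v M) e).
  rewrite /St /set_reg /=; congr State; apply: functional_extensionality => y.
  by rewrite nth_set_nth.
exact: exec_assign.
Qed.

(* The memory [M] with the word [L] stored from address [o] on. *)
Definition wr (M : nat -> nat) (o : nat) (L : seq nat) : nat -> nat :=
  fun b => if o <= b < o + size L then nth 0 L (b - o) else M b.

Lemma runs_write a e v M :
  runs (Write a e) (St v M) (cost a + cost e).+1
       (St v (wr M (eval (St v M) a) [:: eval (St v M) e])).
Proof.
exists (cost a + cost e).+1 => //.
set A := eval _ a; set X := eval _ e.
have -> : St v (wr M A [:: X]) = set_mem (St v M) A X.
  rewrite /St /set_mem /wr /=; congr State; apply: functional_extensionality => y.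
  have [->|neq] := eqVneq y A; first by rewrite leqnn addn1 ltnSn /= subnn.
  by case: ifP => // h; lia.
exact: exec_store.
Qed.

Lemma runs_ifT e c1 c2 s s' T :
  eval s e != 0 -> runs c1 s T s' -> runs (If e c1 c2) s (cost e + T).+1 s'.
Proof.
by move=> h [t et lt]; exists (cost e + t).+1; [apply: exec_if_true | rewrite ltnS leq_add2l].
Qed.

Lemma runs_ifF e c1 c2 s s' T :
  eval s e = 0 -> runs c2 s T s' -> runs (If e c1 c2) s (cost e + T).+1 s'.
Proof.
by move=> h [t et lt]; exists (cost e + t).+1; [apply: exec_if_false | rewrite ltnS leq_add2l].
Qed.

Lemma runs_while e c N (s : nat -> state) (T : nat -> nat) :
  (forall k, k < N -> eval (s k) e != 0) -> eval (s N) e = 0 ->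
  (forall k, k < N -> runs c (s k) (T k) (s k.+1)) ->
  runs (While e c) (s 0) (\sum_(k < N) (T k + (cost e).+1) + (cost e).+1) (s N).
Proof.
elim: N s T => [|N IH] s T hne h0 hb.
  by rewrite big_ord0; exists (cost e).+1 => //; apply: exec_while_stop.
have [t1 e1 l1] := hb 0 isT.
have [||k lk|t2 e2 l2] := IH (fun k => s k.+1) (fun k => T k.+1).
- by move=> k lk; apply: hne.
- exact: h0.
- by apply: hb.
exists (cost e + t1 + t2).+1; last first.
  rewrite big_ord_recl (eq_bigr (fun k : 'I_N => T k.+1 + (cost e).+1)) //=.
  by move: l2; set X := \sum_(k < N) _; lia.
by apply: exec_while_step e1 e2; apply: hne.
Qed.

Definition For (x : nat) (e : expr) (c : cmd) : cmd :=
  Seq (Assign x (Cst 0))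
      (While (Leq (Add (Var x) (Cst 1)) e) (Seq c (Assign x (Add (Var x) (Cst 1))))).

(** The body has to reach the state of the next round except for the counter, which must be [k]
    again when it ends: the loop itself increments it. *)
Lemma runs_for x e c N (T : nat -> nat) v M0 v' M' (u : nat -> seq nat) (M : nat -> nat -> nat) :
  set_nth 0 v x 0 = u 0 -> M 0 = M0 -> u N = v' -> M N = M' ->
  (forall k, k <= N -> eval (St (u k) (M k)) e = N /\ nth 0 (u k) x = k) ->
  (forall k, k < N -> runs c (St (u k) (M k)) (T k) (St (set_nth 0 (u k.+1) x k) (M k.+1))) ->
  runs (For x e c) (St v M0) (\sum_(k < N) (T k + (cost e + 10)) + (cost e + 10)) (St v' M').
Proof.
move=> hu <- <- <- hN hb.
have := @runs_while (Leq (Add (Var x) (Cst 1)) e) (Seq c (Assign x (Add (Var x) (Cst 1))))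
  N (fun k => St (u k) (M k)) (fun k => T k + 4).
case=> [k lk||k lk|t et lt].
- by have /= [-> ->] := hN k (ltnW lk); rewrite addn1 lk.
- by have /= [-> ->] := hN N (leqnn N); rewrite addn1 ltnn.
- apply: runs_seq (hb k lk) _; apply: runs_assign => /=.
  rewrite nth_set_nth /= eqxx set_set_nth eqxx addn1.
  have [_ hx] := hN _ lk; rewrite -[X in set_nth _ _ _ X]hx.
  (* Register lists that differ only in trailing zeros are different lists. A counter beyond the end
     of the list would read 0 and not [k.+1], so the list is long enough. *)
  have [lt|ge] := ltnP x (size (u k.+1)).
    apply: (@eq_from_nth _ 0) => [|i _]; first by rewrite size_set_nth; lia.
    by rewrite nth_set_nth /=; case: eqP => // ->.
  by have := hx; rewrite nth_default.
exists (2 + t).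
  apply: exec_seq et; rewrite -hu.
  have := exec_assign (St v (M 0)) x (Cst 0).
  suff -> : set_reg (St v (M 0)) x (eval (St v (M 0)) (Cst 0)) = St (set_nth 0 v x 0) (M 0) by [].
  rewrite /St /set_reg /=; congr State; apply: functional_extensionality => y.
  by rewrite nth_set_nth.
apply: leq_trans (leq_add (leqnn 2) lt) _ => /=.
have : \sum_(k < N) (T k + 4 + (3 + cost e).+2) <= \sum_(k < N) (T k + (cost e + 10)).
  by apply: leq_sum => k _; lia.
set A := \sum_(k < N) _; set B := \sum_(k < N) _; lia.
Qed.

Lemma wr_cat M o L1 L2 : wr (wr M o L1) (o + size L1) L2 = wr M o (L1 ++ L2).
Proof.
apply: functional_extensionality => b; rewrite /wr size_cat nth_cat.
by repeat case: ifP => ?; try lia; congr nth; lia.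
Qed.

(** For words completed from the front: the header of a cluster is known only after its edges are
    written, and the discretized sequence is filled from its end. *)
Lemma wr_precat M o L1 L2 : wr (wr M (o + size L1) L2) o L1 = wr M o (L1 ++ L2).
Proof.
apply: functional_extensionality => b; rewrite /wr size_cat nth_cat.
by repeat case: ifP => ?; try lia; congr nth; lia.
Qed.

Lemma wr_nil M o : wr M o [::] = M.
Proof. by apply: functional_extensionality => b; rewrite /wr /= addn0; case: ifP => // ?; lia. Qed.

Lemma wr_lt M o L b : b < o -> wr M o L b = M b.
Proof. by rewrite /wr => h; case: ifP => // ?; lia. Qed.

Lemma wr_in M o L i : i < size L -> wr M o L (o + i) = nth 0 L i.
Proof. by rewrite /wr => h; case: ifP; rewrite ?addKn // => ?; lia. Qed.

Local Notation "c1 ;; c2" := (Seq c1 c2) (at level 90, right associativity).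

Lemma runs_eq c s T s' v M v' M' :
  runs c s T (St v M) -> v = v' -> M = M' -> s' = St v' M' -> runs c s T s'.
Proof. by move=> h <- <- ->. Qed.

Lemma runs_if e c1 c2 s s' T :
  (eval s e != 0 -> runs c1 s T s') -> (eval s e = 0 -> runs c2 s T s') ->
  runs (If e c1 c2) s (cost e + T).+1 s'.
Proof.
move=> h1 h2; have [h|h] := eqVneq (eval s e) 0.
  exact: runs_ifF h (h2 h).
exact: runs_ifT h (h1 h).
Qed.

Lemma runs_for_const x e c N T v M0 v' M' (u : nat -> seq nat) (M : nat -> nat -> nat) :
  set_nth 0 v x 0 = u 0 -> M 0 = M0 -> u N = v' -> M N = M' ->
  (forall k, k <= N -> eval (St (u k) (M k)) e = N /\ nth 0 (u k) x = k) ->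
  (forall k, k < N -> runs c (St (u k) (M k)) T (St (set_nth 0 (u k.+1) x k) (M k.+1))) ->
  runs (For x e c) (St v M0) (N * (T + (cost e + 10)) + (cost e + 10)) (St v' M').
Proof.
move=> h1 h2 h3 h4 h5 h6.
have := runs_for h1 h2 h3 h4 h5 (T := fun=> T) h6.
by rewrite sum_nat_const card_ord.
Qed.

Ltac asg := eapply runs_assign; rewrite /=; reflexivity.
Ltac lsteq := repeat (apply: (f_equal2 cons)); rewrite //; try lia.

(** * The program *)

Definition flat (L : seq (nat * nat * bool)) : seq nat :=
  flatten [seq [:: e.1.1; e.1.2; nat_of_bool e.2] | e <- L].

Lemma size_flat L : size (flat L) = 3 * size L.
Proof. by elim: L => //= e L IH; rewrite IH; lia. Qed.

Lemma flat_cat L1 L2 : flat (L1 ++ L2) = flat L1 ++ flat L2.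
Proof. by rewrite /flat map_cat flatten_cat. Qed.

(* Registers: 0 number of tasks, 2 current slot, 3 first slot of the current
   cluster, 4 start of its output word, 5 output pointer, 6 number of edges
   written, 7 next new vertex, 8 number k of red edges, 9 weight of the current
   deadline, 10 and 11 loop counters for tasks and slots relative to the
   cluster, 14 inner loop counter, 16 size of the cluster; 1, 12, 13 and 15 are
   auxiliary. Memory: sorted deadlines from address 0 on, discretized sequence
   from address n on, output from address 2n on. *)
Definition emit (a b : expr) (r : bool) : cmd :=
  Write (Var 5) a ;; Write (Add (Var 5) (Cst 1)) b ;;
  Write (Add (Var 5) (Cst 2)) (Cst r) ;;
  Assign 5 (Add (Var 5) (Cst 3)) ;; Assign 6 (Add (Var 6) (Cst 1)).

(** [b] is evaluated after a cell has been overwritten, hence operands whose value is the same in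
    every memory. *)
Lemma runs_emit a b r v M H L va vb :
  nth 0 v 5 = H + 3 * size L -> nth 0 v 6 = size L ->
  (forall M', eval (St v M') a = va) -> (forall M', eval (St v M') b = vb) ->
  runs (emit a b r) (St v (wr M H (flat L))) (cost a + cost b + 20)
    (St (set_nth 0 (set_nth 0 v 5 (H + 3 * size (rcons L (va, vb, r)))) 6
           (size (rcons L (va, vb, r))))
        (wr M H (flat (rcons L (va, vb, r))))).
Proof.
move=> h5 h6 ha hb; eapply runs_weaken; last first.
  eapply runs_seq; first exact: runs_write.
  eapply runs_seq; first exact: runs_write.
  eapply runs_seq; first exact: runs_write.
  eapply runs_seq; first by apply: runs_assign.
  eapply runs_eq; first by apply: runs_assign.
  - reflexivity.
  - reflexivity.
  rewrite /= !ha !hb /= h5 !nth_set_nth /= h6 !size_rcons.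
  rewrite -cats1 flat_cat.
  rewrite -[flat [:: _]]/([:: va] ++ [:: vb] ++ [:: nat_of_bool r]).
  by rewrite -!wr_cat /= size_flat mulnS !addn1 [3 + _]addnC addnA addn2.
by rewrite /=; lia.
Qed.

(** The vertex where the red edge of round [t] starts; at [t = w] it is the far end of the path. *)
Definition prev_vertex (u z t : nat) : nat := if t is t'.+1 then (z + 2 * t').+1 else u.

Definition links (u z w : nat) : seq (nat * nat * bool) :=
  flatten [seq [:: (prev_vertex u z t, z + 2 * t, true); (z + 2 * t, (z + 2 * t).+1, false)]
          | t <- iota 0 w].

Definition finals (m p h : nat) : seq (nat * nat * bool) :=
  [seq (m + j, p, false) | j <- iota 0 h].

Lemma iota0S n : iota 0 n.+1 = rcons (iota 0 n) n.
Proof. by rewrite -addn1 iotaD cats1. Qed.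

Lemma links_S u z w : links u z w.+1 =
  rcons (rcons (links u z w) (prev_vertex u z w, z + 2 * w, true))
    (z + 2 * w, (z + 2 * w).+1, false).
Proof. by rewrite /links iota0S map_rcons flatten_rcons /= -!cats1 -catA. Qed.

Lemma finals_S m p h : finals m p h.+1 = rcons (finals m p h) (m + h, p, false).
Proof. by rewrite /finals iota0S map_rcons. Qed.

(* The path for a pair of a slot [u] and a deadline of weight [w], with new
   vertices [z], ..., [z + 2 * w - 1]: its last vertex is joined to the [h]
   ranks [m], ..., [m + h - 1], and every second edge is red, starting with
   the one at [u]. *)
Definition chain (m u w h z : nat) : seq (nat * nat * bool) :=
  links u z w ++ finals m (prev_vertex u z w) h.

(** Up to the first loop over register 9, the code computes [width] in register 13; the two outer
    tests say that the slot is a real position and does not exceed the deadline. *)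
Definition gadget_cmd : cmd :=
  let alpha := Read (Add (Add (Var 0) (Var 3)) (Var 11)) in
  let delta := Read (Add (Var 3) (Var 10)) in
  Assign 12 (Add alpha delta) ;;
  For 14 (Var 0)
    (Assign 13 (Add (Var 13) (Leq (Read (Add (Var 0) (Var 14))) (Var 12)))) ;;
  If (Leq (Add (Var 0) (Cst 1)) alpha)
    (If (Leq alpha (Add delta (Var 0)))
      (Assign 13 (Defs.Sub (Var 12) (Add (Add (Var 13) (Var 0)) (Var 3))) ;;
       If (Leq (Var 13) (Var 16)) Skip (Assign 13 (Var 16)))
      (Assign 13 (Cst 0)))
    (Assign 13 (Cst 0)) ;;
  Assign 15 (Var 11) ;;
  For 14 (Var 9)
    (emit (Var 15) (Var 7) true ;; emit (Var 7) (Add (Var 7) (Cst 1)) false ;;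
     Assign 15 (Add (Var 7) (Cst 1)) ;; Assign 7 (Add (Var 7) (Cst 2))) ;;
  For 14 (Var 13) (emit (Add (Var 16) (Var 14)) (Var 15) false) ;;
  Assign 12 (Cst 0) ;; Assign 13 (Cst 0) ;; Assign 14 (Cst 0) ;; Assign 15 (Cst 0).

Definition rank_count (N : nat) (ar : nat -> nat) (X : nat) : nat :=
  count (fun l => ar l <= X) (iota 0 N).

(* The ranks compatible with a slot and a deadline form an initial segment of
   the ranks of the cluster; this is its length. *)
Definition width (N : nat) (ar d : nat -> nat) (i0 m T U : nat) : nat :=
  let X := ar (i0 + U) + d (i0 + T) in
  if (N < ar (i0 + U)) && (ar (i0 + U) <= d (i0 + T) + N)
  then minn m (X - (rank_count N ar X + N + i0)) else 0.

Lemma runs_gadget N J i0 H Z K W T U m Mb ar d L :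
  2 * N <= H -> i0 + U < N -> i0 + T < N ->
  (forall l, l < N -> Mb l = d l) -> (forall l, l < N -> Mb (N + l) = ar l) ->
  let L' := L ++ chain m U W (width N ar d i0 m T U) Z in
  runs gadget_cmd
    (St [:: N; 0; J; i0; H; H + 3 + 3 * size L; size L; Z; K; W; T; U; 0; 0; 0; 0; m]
        (wr Mb (H + 3) (flat L)))
    (100 * (N + W + m + 2))
    (St [:: N; 0; J; i0; H; H + 3 + 3 * size L'; size L'; Z + 2 * W; K; W; T; U; 0; 0; 0; 0; m]
        (wr Mb (H + 3) (flat L'))).
Proof.
move=> hH hU hT hd ha.
set h := width N ar d i0 m T U => L'.
have rd l : l < N -> wr Mb (H + 3) (flat L) l = d l by move=> lN; rewrite wr_lt ?hd //; lia.
have ra l : l < N -> wr Mb (H + 3) (flat L) (N + l) = ar l by move=> lN; rewrite wr_lt ?ha //; lia.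
have raU : wr Mb (H + 3) (flat L) (N + i0 + U) = ar (i0 + U) by rewrite -addnA ra.
have rdT := rd _ hT.
have hm : h <= m by rewrite /h /width; case: ifP => // _; exact: geq_minl.
pose X := ar (i0 + U) + d (i0 + T).
eapply runs_weaken; last first.
  eapply runs_seq.
    apply: (@runs_assign _ _ _ [:: N; 0; J; i0; H; H + 3 + 3 * size L; size L; Z; K; W; T; U; X; 0; 0; 0; m]).
    by rewrite /= raU rdT.
  eapply runs_seq.
    apply: (@runs_for_const _ _ _ N 20 _ _ [:: N; 0; J; i0; H; H + 3 + 3 * size L; size L; Z; K; W; T; U; X; rank_count N ar X; N; 0; m] _
       (fun k => [:: N; 0; J; i0; H; H + 3 + 3 * size L; size L; Z; K; W; T; U; X; rank_count k ar X; k; 0; m])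
       (fun=> wr Mb (H + 3) (flat L))) => // k lk.
    eapply runs_weaken; last first.
      apply: runs_assign; rewrite /= ra // /rank_count iota0S -cats1 count_cat /= addn0; reflexivity.
    by [].
  eapply runs_seq.
    apply: (@runs_if _ _ _ _ (St [:: N; 0; J; i0; H; H + 3 + 3 * size L; size L; Z; K; W; T; U; X; h; N; 0; m] (wr Mb (H + 3) (flat L))) 40).
      rewrite /= raU addn1 => h1.
      eapply runs_weaken; last first.
        apply: (runs_if (T := 25)).
          rewrite /= raU rdT => h2.
          eapply runs_weaken; last first.
            eapply runs_seq; first by apply: runs_assign.
            rewrite /=.
            apply: (runs_if (T := 3)) => /= h3.
              eapply runs_weaken; last first.
                eapply runs_eq; first exact: runs_skip.
                - reflexivity.
                - reflexivity.
                congr St; lsteq; rewrite /h /width -/X; case: ifP; lia.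
              by [].
            eapply runs_weaken; last first.
              eapply runs_eq; first by apply: runs_assign.
              - reflexivity.
              - reflexivity.
              congr St; rewrite /=; lsteq; rewrite /h /width -/X; case: ifP; lia.
            by [].
          by [].
        rewrite /= raU rdT => h2.
        eapply runs_weaken; last first.
          eapply runs_eq; first by apply: runs_assign.
          - reflexivity.
          - reflexivity.
          congr St; rewrite /=; lsteq; rewrite /h /width -/X; case: ifP; lia.
        by [].
      by [].
    rewrite /= raU addn1 => h1.
    eapply runs_weaken; last first.
      eapply runs_eq; first by apply: runs_assign.
      - reflexivity.
      - reflexivity.
      congr St; rewrite /=; lsteq; rewrite /h /width -/X; case: ifP; lia.
    by [].
  eapply runs_seq; first by asg.
  eapply runs_seq.
    pose LL k := L ++ links U Z k.
    apply: (@runs_for_const _ _ _ W 70 _ _ [:: N; 0; J; i0; H; H + 3 + 3 * size (LL W); size (LL W); Z + 2 * W; K; W; T; U; X; h; W; prev_vertex U Z W; m] _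
       (fun k => [:: N; 0; J; i0; H; H + 3 + 3 * size (LL k); size (LL k); Z + 2 * k; K; W; T; U; X; h; k; prev_vertex U Z k; m])
       (fun k => wr Mb (H + 3) (flat (LL k)))) => //.
    - by rewrite /LL /links /= cats0 muln0 addn0.
    - by rewrite /LL /links /= cats0.
    - move=> k lk; rewrite /= /LL links_S -!rcons_cat -/(LL k).
      eapply runs_weaken; last first.
        eapply runs_seq.
          by apply: runs_emit => //= M'; reflexivity.
        rewrite /=; eapply runs_seq.
          by apply: runs_emit => //= M'; reflexivity.
        rewrite /=; eapply runs_seq; first by asg.
        eapply runs_eq; first by apply: runs_assign.
        - reflexivity.
        - reflexivity.
        by rewrite /= !addn1; congr St; lsteq.
      by [].
  eapply runs_seq.
    pose LL k := L ++ links U Z W ++ finals m (prev_vertex U Z W) k.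
    apply: (@runs_for_const _ _ _ h 50 _ _ [:: N; 0; J; i0; H; H + 3 + 3 * size (LL h); size (LL h); Z + 2 * W; K; W; T; U; X; h; h; prev_vertex U Z W; m] _
       (fun k => [:: N; 0; J; i0; H; H + 3 + 3 * size (LL k); size (LL k); Z + 2 * W; K; W; T; U; X; h; k; prev_vertex U Z W; m])
       (fun k => wr Mb (H + 3) (flat (LL k)))) => //.
    - by rewrite /LL /finals /= cats0.
    - by rewrite /LL /finals /= cats0.
    - move=> k lk; rewrite /= /LL finals_S -!rcons_cat -/(LL k).
      eapply runs_weaken; last first.
        by apply: runs_emit => //= M'; reflexivity.
      by [].
  eapply runs_seq; first by asg.
  eapply runs_seq; first by asg.
  eapply runs_seq; first by asg.
  by apply: runs_assign.
by rewrite /=; lia.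
Qed.

(** A triple consists of a slot, a weight and a width. The inner vertices of successive chains are
    numbered consecutively from [z] on. *)
Fixpoint edges (m z : nat) (gs : seq (nat * nat * nat)) : seq (nat * nat * bool) :=
  if gs is g :: gs' then chain m g.1.1 g.1.2 g.2 z ++ edges m (z + 2 * g.1.2) gs' else [::].

Definition inner_vertices (gs : seq (nat * nat * nat)) : nat :=
  2 * sumn [seq g.1.2 | g <- gs].

Lemma inner_vertices_cat g1 g2 :
  inner_vertices (g1 ++ g2) = inner_vertices g1 + inner_vertices g2.
Proof. by rewrite /inner_vertices map_cat sumn_cat mulnDr. Qed.

Lemma edges_cat m z g1 g2 :
  edges m z (g1 ++ g2) = edges m z g1 ++ edges m (z + inner_vertices g1) g2.
Proof.
elim: g1 z => [|g g1 IH] z; first by rewrite /inner_vertices /= muln0 addn0.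
by rewrite /= IH -catA /inner_vertices /= mulnDr addnA.
Qed.

Section ClusterGadgets.
Variables (N : nat) (ar d : nat -> nat) (i0 m : nat).

(* A class consists of the equal deadlines of the cluster; its last element
   represents it, and [class_rank] numbers the classes from 0 on. *)
Definition class_end (T : nat) : bool := (T.+1 == m) || (d (i0 + T).+1 != d (i0 + T)).

Definition class_rank (T : nat) : nat := count class_end (iota 0 T).

Definition weight (T : nat) : nat := N.+1 ^ class_rank T.

Definition class_gadgets (T k : nat) : seq (nat * nat * nat) :=
  [seq (U, weight T, width N ar d i0 m T U) | U <- iota 0 k].

Definition gadgets (k : nat) : seq (nat * nat * nat) :=
  flatten [seq class_gadgets T m | T <- iota 0 k & class_end T].

(** Runs over all tasks and not only over class ends, so that each deadline counts with its
    multiplicity. *)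
Definition red_target (k : nat) : nat := sumn [seq weight T | T <- iota 0 k].

Lemma class_gadgets_S T k :
  class_gadgets T k.+1 = class_gadgets T k ++ [:: (k, weight T, width N ar d i0 m T k)].
Proof. by rewrite /class_gadgets iota0S map_rcons cats1. Qed.

Lemma gadgets_S k :
  gadgets k.+1 = gadgets k ++ (if class_end k then class_gadgets k m else [::]).
Proof.
rewrite /gadgets iota0S filter_rcons; case: ifP => _; last by rewrite cats0.
by rewrite map_rcons flatten_rcons.
Qed.

Lemma weight_S T : weight T.+1 = (if class_end T then N.+1 else 1) * weight T.
Proof.
rewrite /weight /class_rank iota0S -cats1 count_cat /= addn0.
by case: class_end; rewrite ?addn1 ?expnS ?addn0 ?mul1n.
Qed.

Lemma red_target_S k : red_target k.+1 = red_target k + weight k.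
Proof. by rewrite /red_target iota0S map_rcons sumn_rcons. Qed.

Lemma inner_vertices1 u w h : inner_vertices [:: (u, w, h)] = 2 * w.
Proof. by rewrite /inner_vertices /= addn0. Qed.

End ClusterGadgets.

(** The sum in the test is a disjunction. The machine has no multiplication, so the weight is
    multiplied by n + 1 through repeated addition. *)
Definition task_cmd : cmd :=
  Assign 8 (Add (Var 8) (Var 9)) ;;
  If (Add (Eqn (Add (Var 10) (Cst 1)) (Var 16))
          (Defs.Sub (Cst 1) (Eqn (Read (Add (Add (Var 3) (Var 10)) (Cst 1))) (Read (Add (Var 3) (Var 10))))))
     (For 11 (Var 16) gadget_cmd ;; Assign 11 (Cst 0) ;;
      For 14 (Add (Var 0) (Cst 1)) (Assign 12 (Add (Var 12) (Var 9))) ;;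
      Assign 9 (Var 12) ;; Assign 12 (Cst 0) ;; Assign 14 (Cst 0))
     Skip.

(** Only class ends are expensive; summed over the tasks of a cluster this gives a factor p and not
    m. *)
Definition task_time (N m : nat) (last : bool) (w : nat) : nat :=
  if last then m * (100 * (N + w + m + 2) + 11) + 40 * N + 100 else 100.

Lemma runs_task N J i0 H m Mb ar d T :
  2 * N <= H -> i0 + m <= N -> T < m ->
  (forall l, l < N -> Mb l = d l) -> (forall l, l < N -> Mb (N + l) = ar l) ->
  let gs k := gadgets N ar d i0 m k in
  let L k := edges m (m + m) (gs k) in
  let v k T := [:: N; 0; J; i0; H; H + 3 + 3 * size (L k); size (L k);
                m + m + inner_vertices (gs k); red_target N d i0 m k; weight N d i0 m k;
                T; 0; 0; 0; 0; 0; m] in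
  runs task_cmd
    (St (v T T) (wr Mb (H + 3) (flat (L T))))
    (task_time N m (class_end d i0 m T) (weight N d i0 m T))
    (St (v T.+1 T) (wr Mb (H + 3) (flat (L T.+1)))).
Proof.
move=> hH hm hT hd ha gs L v.
have rd l : l < N -> wr Mb (H + 3) (flat (L T)) l = d l by move=> lN; rewrite wr_lt ?hd //; lia.
set w := weight N d i0 m T.
(* For the last task of the cluster the cell read may lie outside the cluster or even outside the
   deadlines, but the first summand is then already 1. *)
have test : (class_end d i0 m T) =
   (nat_of_bool (T + 1 == m) + (1 - nat_of_bool (wr Mb (H + 3) (flat (L T)) (i0 + T + 1) == wr Mb (H + 3) (flat (L T)) (i0 + T))) != 0).
  rewrite /class_end addn1; case: (T.+1 =P m) => // ne.
  by rewrite !addn1 !rd /=; [case: eqP | lia | lia].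
rewrite /task_time; case e: (class_end d i0 m T); last first.
  eapply runs_weaken; last first.
    eapply runs_seq; first by asg.
    rewrite /=; apply: runs_ifF; first by apply/eqP/negbFE; rewrite /= -test.
    eapply runs_eq; first exact: runs_skip.
    - reflexivity.
    - reflexivity.
    by rewrite /v /L /gs gadgets_S e cats0 red_target_S weight_S e mul1n.
  by [].
eapply runs_weaken; last first.
  eapply runs_seq; first by asg.
  rewrite /=; apply: runs_ifT; first by rewrite /= -test.
  pose LU k := L T ++ edges m (m + m + inner_vertices (gs T)) (class_gadgets N ar d i0 m T k).
  pose vU k U X L14 W := [:: N; 0; J; i0; H; H + 3 + 3 * size (LU k); size (LU k);
         m + m + inner_vertices (gs T ++ class_gadgets N ar d i0 m T k); red_target N d i0 m T.+1; W;
                T; U; X; 0; L14; 0; m].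
  have LUS k : LU k.+1 = LU k ++ chain m k w (width N ar d i0 m T k)
                 (m + m + inner_vertices (gs T ++ class_gadgets N ar d i0 m T k)).
    by rewrite /LU class_gadgets_S edges_cat catA /= cats0 inner_vertices_cat addnA.
  eapply runs_seq.
    apply: (@runs_for_const _ _ _ m (100 * (N + w + m + 2)) _ _ (vU m m 0 0 w) _
       (fun k => vU k k 0 0 w)
       (fun k => wr Mb (H + 3) (flat (LU k)))) => //.
    - by rewrite /vU /LU /= !cats0 red_target_S.
    - by rewrite /LU /= cats0.
    - move=> k lk; rewrite /= LUS.
      have -> : m + m + inner_vertices (gs T ++ class_gadgets N ar d i0 m T k.+1) =
        m + m + inner_vertices (gs T ++ class_gadgets N ar d i0 m T k) + 2 * w.
        by rewrite class_gadgets_S catA inner_vertices_cat inner_vertices1 addnA.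
      by apply: runs_gadget => //; lia.
  eapply runs_seq; first by asg.
  eapply runs_seq.
    apply: (@runs_for_const _ _ _ N.+1 10 _ _ (vU m 0 (N.+1 * w) N.+1 w) _
       (fun k => vU m 0 (k * w) k w) (fun=> wr Mb (H + 3) (flat (LU m)))) => //.
    - by move=> k lk /=; rewrite addn1.
    - move=> k lk; eapply runs_weaken; last first.
        eapply runs_eq; first by apply: runs_assign.
        - reflexivity.
        - reflexivity.
        by rewrite /vU /= (mulSnr k w).
      by [].
  eapply runs_seq; first by asg.
  eapply runs_seq; first by asg.
  eapply runs_eq; first by apply: runs_assign.
  - reflexivity.
  - reflexivity.
  by rewrite /v /L /gs gadgets_S e weight_S e edges_cat -/(L T) -/(gs T) /LU.
by rewrite /=; lia.
Qed.

Definition cluster_cmd : cmd :=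
  Assign 16 (Defs.Sub (Add (Var 2) (Cst 1)) (Var 3)) ;; Assign 4 (Var 5) ;;
  Assign 5 (Add (Var 5) (Cst 3)) ;; Assign 7 (Add (Var 16) (Var 16)) ;; Assign 9 (Cst 1) ;;
  For 10 (Var 16) task_cmd ;;
  Write (Var 4) (Var 7) ;; Write (Add (Var 4) (Cst 1)) (Var 6) ;;
  Write (Add (Var 4) (Cst 2)) (Var 8) ;;
  Assign 3 (Add (Var 2) (Cst 1)) ;; Assign 4 (Cst 0) ;; Assign 6 (Cst 0) ;; Assign 7 (Cst 0) ;;
  Assign 8 (Cst 0) ;; Assign 9 (Cst 0) ;; Assign 10 (Cst 0) ;; Assign 16 (Cst 0).

Definition cluster_word (N : nat) (ar d : nat -> nat) (i0 m : nat) : seq nat :=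
  let gs := gadgets N ar d i0 m m in
  let L := edges m (m + m) gs in
  [:: m + m + inner_vertices gs; size L; red_target N d i0 m m] ++ flat L.

Definition cluster_time (N : nat) (d : nat -> nat) (i0 m : nat) : nat :=
  \sum_(T < m) (task_time N m (class_end d i0 m T) (weight N d i0 m T) + 11) + 150.

Definition idle_regs (N J i0 O : nat) : seq nat :=
  [:: N; 0; J; i0; 0; O; 0; 0; 0; 0; 0; 0; 0; 0; 0; 0; 0].

Lemma runs_cluster N J i0 H Mb ar d :
  2 * N <= H -> i0 <= J < N ->
  (forall l, l < N -> Mb l = d l) -> (forall l, l < N -> Mb (N + l) = ar l) ->
  let w := cluster_word N ar d i0 (J.+1 - i0) in
  runs cluster_cmd
    (St (idle_regs N J i0 H) Mb) (cluster_time N d i0 (J.+1 - i0))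
    (St (idle_regs N J J.+1 (H + size w)) (wr Mb H w)).
Proof.
move=> hH hJ hd ha; set m := J.+1 - i0 => w.
pose gs k := gadgets N ar d i0 m k.
pose L k := edges m (m + m) (gs k).
pose v k T := [:: N; 0; J; i0; H; H + 3 + 3 * size (L k); size (L k);
                m + m + inner_vertices (gs k); red_target N d i0 m k; weight N d i0 m k;
                T; 0; 0; 0; 0; 0; m].
eapply runs_weaken; last first.
  rewrite /idle_regs.
  eapply runs_seq.
    apply: (@runs_assign _ _ _ [:: N; 0; J; i0; 0; H; 0; 0; 0; 0; 0; 0; 0; 0; 0; 0; m]).
    by rewrite /= addn1.
  eapply runs_seq; first by asg.
  eapply runs_seq; first by asg.
  eapply runs_seq; first by asg.
  eapply runs_seq; first by asg.
  eapply runs_seq.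
    apply: (@runs_for _ _ _ m (fun T => task_time N m (class_end d i0 m T) (weight N d i0 m T)) _ _
       (v m m) _ (fun k => v k k)
       (fun k => wr Mb (H + 3) (flat (L k)))) => //.
    - by rewrite /v /L /gs /inner_vertices /= !addn0.
    - by rewrite /L /gs /= wr_nil.
    - by move=> k lk; apply: runs_task => //; lia.
  eapply runs_seq; first exact: runs_write.
  eapply runs_seq; first exact: runs_write.
  eapply runs_seq; first exact: runs_write.
  do 7 (eapply runs_seq; first by asg).
  eapply runs_eq; first by apply: runs_assign.
  - reflexivity.
  - reflexivity.
  rewrite /= /idle_regs.
  rewrite (wr_cat _ H [:: _] [:: _]) (wr_cat _ H [:: _; _] [:: _]).
  rewrite (wr_precat _ H [:: _; _; _]) /= addn1 /w /cluster_word.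
  congr St; lsteq.
  by rewrite /= size_flat -/(gs m) -/(L m); lia.
rewrite /= /cluster_time -[1 + 10]/11 -/m; set A := \sum_(k < m) (_ + 11); lia.
Qed.

(** * Sorting and discretizing in memory *)

Definition swap_if (M : nat -> nat) (k j : nat) : nat -> nat :=
  if M k < M j then wr (wr M j [:: M k]) k [:: M j] else M.

(** Insertion into the sorted prefix with cell [k] as buffer: it takes over each entry that exceeds
    it and leaves its old value behind. *)
Definition insert_mem (M : nat -> nat) (k j : nat) : nat -> nat :=
  iteri j (fun i M' => swap_if M' k i) M.

Definition sort_mem (M : nat -> nat) (k : nat) : nat -> nat :=
  iteri k (fun i M' => insert_mem M' i i) M.

Lemma wr1 M a x y : wr M a [:: x] y = if y == a then x else M y.
Proof.
rewrite /wr /=; case: eqP => [->|ne]; first by rewrite leqnn addn1 ltnSn /= subnn.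
by case: ifP => // ?; lia.
Qed.

Lemma swap_ifE M k j x : swap_if M k j x =
  if M k < M j then (if x == k then M j else if x == j then M k else M x) else M x.
Proof. by rewrite /swap_if; case: ifP => // _; rewrite !wr1. Qed.

Definition transpose_nat (k j x : nat) : nat := if x == k then j else if x == j then k else x.

Lemma perm_swap_if M k j n : k < n -> j < n ->
  perm_eq (mkseq (swap_if M k j) n) (mkseq M n).
Proof.
move=> kn jn; case: (ltnP (M k) (M j)) => lt; last first.
  by rewrite (eq_mkseq (g := M)) // => x; rewrite swap_ifE ltnNge lt.
have -> : mkseq (swap_if M k j) n = map M (map (transpose_nat k j) (iota 0 n)).
  rewrite -map_comp; apply: eq_map => x /=; rewrite swap_ifE lt /transpose_nat.
  by case: eqP => // _; case: eqP.
apply: perm_map; have inj : injective (transpose_nat k j).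
  by move=> x y; rewrite /transpose_nat; repeat case: eqP => ?; lia.
apply: uniq_perm; rewrite ?map_inj_uniq ?iota_uniq // => x.
rewrite mem_iota /=; apply/mapP/idP => [[y]|xn].
  by rewrite mem_iota /transpose_nat => /= yn ->; repeat case: eqP => ?; lia.
exists (transpose_nat k j x); last first.
  rewrite /transpose_nat; case: (x =P k) => ?; last case: (x =P j) => ?; repeat case: eqP => ?; lia.
by rewrite mem_iota /transpose_nat; repeat case: eqP => ?; lia.
Qed.

Lemma insert_memP M k n : k < n ->
  (forall a b, a <= b < k -> M a <= M b) ->
  perm_eq (mkseq (insert_mem M k k) n) (mkseq M n) /\
  (forall a b, a <= b <= k -> insert_mem M k k a <= insert_mem M k k b).
Proof.
move=> kn hs.
suff H j : j <= k -> [/\ perm_eq (mkseq (insert_mem M k j) n) (mkseq M n),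
   forall a b, a <= b < k -> insert_mem M k j a <= insert_mem M k j b &
   forall a, a < j -> insert_mem M k j a <= insert_mem M k j k].
  have [H1 H2 H3] := H k (leqnn k); split=> // a b /andP [ab].
  rewrite leq_eqVlt => /orP [/eqP bk|bk]; last by apply: H2; lia.
  by move: ab; rewrite bk leq_eqVlt => /orP [/eqP -> //|]; apply: H3.
elim: j => [|j IH] jk; first by split.
have [H1 H2 H3] := IH (ltnW jk); rewrite /insert_mem iteriS -/(insert_mem M k j).
move: (insert_mem M k j) H1 H2 H3 => F H1 H2 H3; split.
- by apply: perm_trans H1; apply: perm_swap_if => //; lia.
- move=> a b hab; have hab' := H2 a b hab.
  rewrite !swap_ifE; case: ifP => // lt.
  have -> : (a == k) = false by apply/eqP; lia.
  have -> : (b == k) = false by apply/eqP; lia.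
  (* The value put into cell [j] is the old buffer: it dominates the entries before [j] and is
     smaller than the entry that it replaces. *)
  case: (a =P j) => [ea|na]; case: (b =P j) => [eb|nb] //; subst.
    by apply: leq_trans (ltnW lt) hab'.
  by apply: H3; lia.
- move=> a aj; rewrite !swap_ifE eqxx; case: ifP => lt.
    have -> : (a == k) = false by apply/eqP; lia.
    by case: (a =P j) => [_|na]; [exact: ltnW | apply: H2; lia].
  have [->|na] := eqVneq a j; first by rewrite leqNgt lt.
  by apply: H3; lia.
Qed.

Lemma sort_memP (D : seq nat) i : i < size D ->
  sort_mem (nth 0 D) (size D) i = nth 0 (sorted_deadlines D) i.
Proof.
set n := size D => ltin.
suff H k : k <= n -> perm_eq (mkseq (sort_mem (nth 0 D) k) n) D /\
   forall a b, a <= b < k -> sort_mem (nth 0 D) k a <= sort_mem (nth 0 D) k b.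
  have [H1 H2] := H n (leqnn n).
  suff <- : mkseq (sort_mem (nth 0 D) n) n = sorted_deadlines D by rewrite nth_mkseq.
  apply: (sorted_eq leq_trans anti_leq).
  - apply/(sortedP 0) => j; rewrite size_mkseq => lj.
    by rewrite !nth_mkseq; try lia; apply: H2; lia.
  - exact: sort_sorted leq_total D.
  - by apply: perm_trans H1 _; rewrite perm_sym perm_sort.
elim: k => [|k IH] kn; first by split=> [|a b]; [rewrite /sort_mem /= mkseq_nth | lia].
have [H1 H2] := IH (ltnW kn).
rewrite /sort_mem iteriS -/(sort_mem (nth 0 D) k).
have [G1 G2] := insert_memP kn H2.
by split; [exact: perm_trans G1 H1 | move=> a b h; apply: G2; lia].
Qed.

Definition sort_cmd : cmd :=
  For 2 (Var 0)
    (For 3 (Var 2)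
       (Assign 4 (Read (Var 3)) ;;
        If (Leq (Add (Read (Var 2)) (Cst 1)) (Var 4))
          (Write (Var 3) (Read (Var 2)) ;; Write (Var 2) (Var 4)) Skip ;;
        Assign 4 (Cst 0)) ;;
     Assign 3 (Cst 0)).

Lemma runs_sort_cmd N M :
  runs sort_cmd (St (idle_regs N 0 0 0) M) (N * (N * 50 + 50) + 50)
    (St (idle_regs N N 0 0) (sort_mem M N)).
Proof.
rewrite /idle_regs; eapply runs_weaken; last first.
  apply: (@runs_for_const _ _ _ N (N * 50 + 30) _ _ (idle_regs N N 0 0) _
       (fun k => idle_regs N k 0 0) (fun k => sort_mem M k)) => // k lk.
  rewrite /idle_regs /=; eapply runs_weaken; last first.
    eapply runs_seq.
      apply: (@runs_for_const _ _ _ k 30 _ _ (idle_regs N k k 0) _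
       (fun j => idle_regs N k j 0) (fun j => insert_mem (sort_mem M k) k j)) => // j lj.
      have -> : insert_mem (sort_mem M k) k j.+1 = swap_if (insert_mem (sort_mem M k) k j) k j by [].
      rewrite /idle_regs /=; move: (insert_mem _ k j) => F.
      eapply runs_weaken; last first.
        eapply runs_seq; first by asg.
        eapply runs_seq.
          apply: (@runs_if _ _ _ _ (St [:: N; 0; k; j; F j; 0; 0; 0; 0; 0; 0; 0; 0; 0; 0; 0; 0] (swap_if F k j)) 10).
            rewrite /= addn1 => lt; eapply runs_weaken; last first.
              eapply runs_seq; first exact: runs_write.
              eapply runs_eq; first exact: runs_write.
              - reflexivity.
              - reflexivity.
              by rewrite /= /swap_if; move: lt; case: ltnP.
            by [].
          rewrite /= addn1 => lt; eapply runs_weaken; last first.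
            eapply runs_eq; first exact: runs_skip.
            - reflexivity.
            - reflexivity.
            by rewrite /swap_if; move: lt; case: ltnP.
          by [].
        rewrite /=; by asg.
      by [].
    rewrite /idle_regs /=; by asg.
  rewrite /=; nia.
rewrite /=; nia.
Qed.

(* The discretized sequence, shifted by [N] to keep it positive, and computed
   from its last entry downwards. *)
Fixpoint alpha_down (d : nat -> nat) (N k : nat) : nat :=
  if k is k'.+1 then minn (alpha_down d N k').-1 (d (N - k) + N) else d N.-1 + N + 1.

(** At [r = N] this is a sentinel one above the last entry, so that the recursion treats the last
    entry like all others. *)
Definition alpha (d : nat -> nat) (N r : nat) : nat := alpha_down d N (N - r).

Definition alpha_cmd : cmd :=
  Assign 4 (Add (Add (Read (Defs.Sub (Var 0) (Cst 1))) (Var 0)) (Cst 1)) ;;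
  For 2 (Var 0)
    (Assign 4 (Defs.Sub (Var 4) (Cst 1)) ;;
     If (Leq (Add (Add (Read (Defs.Sub (Var 0) (Add (Var 2) (Cst 1)))) (Var 0)) (Cst 1)) (Var 4))
        (Assign 4 (Add (Read (Defs.Sub (Var 0) (Add (Var 2) (Cst 1)))) (Var 0))) Skip ;;
     Write (Defs.Sub (Add (Var 0) (Var 0)) (Add (Var 2) (Cst 1))) (Var 4)) ;;
  Assign 2 (Cst 0) ;; Assign 4 (Cst 0) ;; Assign 5 (Add (Var 0) (Var 0)).

Lemma runs_alpha_cmd N M d :
  (forall l, l < N -> M l = d l) -> 0 < N ->
  runs alpha_cmd (St (idle_regs N N 0 0) M) (N * 70 + 100)
    (St (idle_regs N 0 0 (N + N)) (wr M N [seq alpha d N r | r <- iota 0 N])).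
Proof.
move=> hd N0; rewrite /idle_regs.
pose MM k := wr M (2 * N - k) [seq alpha d N r | r <- iota (N - k) k].
pose v k := [:: N; 0; k; 0; alpha_down d N k; 0; 0; 0; 0; 0; 0; 0; 0; 0; 0; 0; 0].
eapply runs_weaken; last first.
  eapply runs_seq.
    apply: (@runs_assign _ _ _ [:: N; 0; N; 0; alpha_down d N 0; 0; 0; 0; 0; 0; 0; 0; 0; 0; 0; 0; 0]).
    by rewrite /= subn1 hd //; lia.
  eapply runs_seq.
    apply: (@runs_for_const _ _ _ N 50 _ _ (v N) _ v MM) => //.
      by rewrite /MM /= wr_nil.
    move=> k lk; rewrite /v /=.
    have rd : MM k (N - (k + 1)) = d (N - k.+1) by rewrite /MM wr_lt addn1 ?hd //; lia.
    eapply runs_weaken; last first.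
      eapply runs_seq; first by asg.
      eapply runs_seq.
        apply: (@runs_if _ _ _ _ (St [:: N; 0; k; 0; alpha_down d N k.+1; 0; 0; 0; 0; 0; 0; 0; 0; 0; 0; 0; 0] (MM k)) 20).
          rewrite /= rd => lt; eapply runs_weaken; last first.
            eapply runs_eq; first by apply: runs_assign.
            - reflexivity.
            - reflexivity.
            by rewrite /= rd; congr St; lsteq.
          by [].
        rewrite /= rd => lt; eapply runs_weaken; last first.
          eapply runs_eq; first exact: runs_skip.
          - reflexivity.
          - reflexivity.
          by congr St; lsteq.
        by [].
      eapply runs_eq; first exact: runs_write.
      - reflexivity.
      - reflexivity.
      rewrite /= /MM; congr St.
      have -> : 2 * N - k = 2 * N - k.+1 + size [:: alpha_down d N k.+1] by rewrite /=; lia.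
      have -> : N + N - (k + 1) = 2 * N - k.+1 by lia.
      rewrite wr_precat /=; congr (wr _ _ (_ :: _)).
        by rewrite /alpha; have -> : N - (N - k.+1) = k.+1 by lia.
      by have -> : (N - k.+1).+1 = N - k by lia.
    by [].
  eapply runs_seq; first by asg.
  eapply runs_seq; first by asg.
  eapply runs_eq; first by apply: runs_assign.
  - reflexivity.
  - reflexivity.
  by rewrite /MM subnn /=; congr St; congr wr; lia.
rewrite /=; lia.
Qed.

(* Blocks are the clusters; [block_start] is the first slot of the block of [j]. *)
Definition block_end (ar : nat -> nat) (N j : nat) : bool :=
  (j.+1 == N) || (ar j.+1 != (ar j).+1).

Fixpoint block_start (ar : nat -> nat) (N j : nat) : nat :=
  if j is j'.+1 then (if block_end ar N j' then j else block_start ar N j') else 0.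

Lemma block_start_le ar N j : block_start ar N j <= j.
Proof. by elim: j => //= j IH; case: ifP => // _; apply: leq_trans IH _. Qed.

Definition block_word (N : nat) (ar d : nat -> nat) (j : nat) : seq nat :=
  cluster_word N ar d (block_start ar N j) (j.+1 - block_start ar N j).

Definition block_words (N : nat) (ar d : nat -> nat) (k : nat) : seq nat :=
  flatten [seq block_word N ar d j | j <- iota 0 k & block_end ar N j].

Definition blocks_cmd : cmd :=
  For 2 (Var 0)
    (If (Add (Eqn (Add (Var 2) (Cst 1)) (Var 0))
             (Defs.Sub (Cst 1) (Eqn (Read (Add (Add (Var 0) (Var 2)) (Cst 1)))
                               (Add (Read (Add (Var 0) (Var 2))) (Cst 1)))))
        cluster_cmd Skip).

Definition block_time (N : nat) (ar d : nat -> nat) (j : nat) : nat :=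
  if block_end ar N j
  then cluster_time N d (block_start ar N j) (j.+1 - block_start ar N j) else 0.

Lemma block_start_S ar N j :
  block_start ar N j.+1 = if block_end ar N j then j.+1 else block_start ar N j.
Proof. by []. Qed.

Lemma block_words_S N ar d k : block_words N ar d k.+1 =
  block_words N ar d k ++ (if block_end ar N k then block_word N ar d k else [::]).
Proof.
rewrite /block_words iota0S filter_rcons; case: ifP => _; last by rewrite cats0.
by rewrite map_rcons flatten_rcons.
Qed.

Lemma runs_blocks_cmd N Mb ar d :
  (forall l, l < N -> Mb l = d l) -> (forall l, l < N -> Mb (N + l) = ar l) ->
  runs blocks_cmd (St (idle_regs N 0 0 (N + N)) Mb)
    (\sum_(j < N) (block_time N ar d j + 41) + 11)
    (St (idle_regs N N (block_start ar N N) (N + N + size (block_words N ar d N)))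
        (wr Mb (N + N) (block_words N ar d N))).
Proof.
move=> hd ha; eapply runs_weaken; last first.
  apply: (@runs_for _ _ _ N (fun j => block_time N ar d j + 30) _ _
     (idle_regs N N (block_start ar N N) (N + N + size (block_words N ar d N))) _
     (fun j => idle_regs N j (block_start ar N j) (N + N + size (block_words N ar d j)))
     (fun j => wr Mb (N + N) (block_words N ar d j))) => //.
    - by rewrite /idle_regs /= addn0.
    - by rewrite wr_nil.
    move=> k lk.
    set Mk := wr _ _ (block_words N ar d k).
    have rd l : l < N -> Mk l = d l by move=> lN; rewrite /Mk wr_lt ?hd //; lia.
    have ra l : l < N -> Mk (N + l) = ar l by move=> lN; rewrite /Mk wr_lt ?ha //; lia.
    have test : block_end ar N k =
      (nat_of_bool (k + 1 == N) + (1 - nat_of_bool (Mk (N + k + 1) == Mk (N + k) + 1)) != 0).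
      rewrite /block_end !addn1; case: (k.+1 =P N) => // ne.
      rewrite -addnS !ra //=; last by lia.
      by case: eqP.
    case e: (block_end ar N k).
      eapply runs_weaken; last first.
        apply: runs_ifT; first by rewrite /= -test.
        eapply runs_eq; first apply: (@runs_cluster N k _ _ Mk ar d) => //.
        - by rewrite mul2n -addnn leq_addr.
        - by rewrite block_start_le.
        - reflexivity.
        - reflexivity.
        rewrite block_words_S block_start_S e /Mk wr_cat size_cat addnA.
        by [].
      by rewrite /= /block_time e; lia.
    eapply runs_weaken; last first.
      apply: runs_ifF; first by apply/eqP/negbFE; rewrite /= -test.
      eapply runs_eq; first exact: runs_skip.
      - reflexivity.
      - reflexivity.
      by rewrite block_words_S block_start_S e cats0.
    by rewrite /=; lia.
rewrite /= leq_add2r; apply: leq_sum => j _; lia.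
Qed.

Definition main_cmd : cmd :=
  sort_cmd ;; alpha_cmd ;; blocks_cmd ;;
  Assign 1 (Defs.Sub (Var 5) (Add (Var 0) (Var 0))) ;; Assign 0 (Add (Var 0) (Var 0)).

Lemma computes_main (D : seq nat) :
  let N := size D in let d := nth 0 (sorted_deadlines D) in let ar := alpha d N in
  0 < N ->
  computes_in main_cmd D
    (N * (N * 50 + 50) + (N * 70 + 100) + \sum_(j < N) (block_time N ar d j + 41) + 100)
    (block_words N ar d N).
Proof.
move=> N d ar N0.
have input_eq : input D = St (idle_regs N 0 0 0) (nth 0 D).
  rewrite /input /St /idle_regs; congr State; apply: functional_extensionality => x.
  by do 17 (case: x => [|x] //=); rewrite nth_nil.
set M1 := sort_mem (nth 0 D) N.
set M2 := wr M1 N [seq ar r | r <- iota 0 N].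
set w := block_words N ar d N.
suff [t ex le] : runs main_cmd (input D)
    (N * (N * 50 + 50) + (N * 70 + 100) + \sum_(j < N) (block_time N ar d j + 41) + 100)
    (St [:: N + N; size w; N; block_start ar N N; 0; N + N + size w; 0; 0; 0; 0; 0; 0; 0; 0; 0; 0; 0]
        (wr M2 (N + N) w)).
  exists t, (St [:: N + N; size w; N; block_start ar N N; 0; N + N + size w; 0; 0; 0; 0; 0; 0; 0; 0; 0; 0; 0]
        (wr M2 (N + N) w)); split=> //.
  rewrite /output /=; apply: (@eq_from_nth _ 0) => [|i]; rewrite size_map size_iota // => lt.
  by rewrite (nth_map 0) ?size_iota // nth_iota // wr_in.
rewrite input_eq; eapply runs_weaken; last first.
  eapply runs_seq; first exact: runs_sort_cmd.
  eapply runs_seq; first by apply: (@runs_alpha_cmd N _ d) => // l lN; apply: sort_memP.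
  eapply runs_seq.
    apply: (@runs_blocks_cmd N _ ar d) => l lN.
      by rewrite wr_lt //; apply: sort_memP.
    rewrite wr_in ?size_map ?size_iota // (nth_map 0) ?size_iota // nth_iota //.
  eapply runs_seq; first by asg.
  eapply runs_eq; first by apply: runs_assign.
  - reflexivity.
  - reflexivity.
  by rewrite /= addKn.
rewrite /=; set A := \sum_(j < N) _; lia.
Qed.

(** * Exact matchings of listed graphs *)

(** The successor makes the vertex type inhabited, as [inord] requires. *)
Definition edge_set (nv : nat) (e : nat * nat * bool) : {set 'I_nv.-1.+1} :=
  [set inord e.1.1; inord e.1.2].

Definition list_edges (nv : nat) (es : seq (nat * nat * bool)) : {set {set 'I_nv.-1.+1}} :=
  [set s | (s \in [seq edge_set nv e | e <- es]) && (#|s| == 2)].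

Definition list_red (nv : nat) (es : seq (nat * nat * bool)) : {set {set 'I_nv.-1.+1}} :=
  [set s in list_edges nv es | s \in [seq edge_set nv e | e <- es & e.2]].

Lemma list_edges_card2 nv es : [forall e in list_edges nv es, #|e| == 2].
Proof. by apply/forall_inP => e; rewrite inE => /andP []. Qed.

Lemma list_red_sub nv es : list_red nv es \subset list_edges nv es.
Proof. by apply/subsetP => e; rewrite inE => /andP []. Qed.

(* The predecessors only serve to make the instance well formed for all
   arguments; it is used for positive [nv] and [k]. *)
Definition list_instance (nv : nat) (es : seq (nat * nat * bool)) (k : nat) : em_instance :=
  EMInstance (list_edges_card2 nv es) (list_red_sub nv es) (ltn0Sn k.-1).

Definition incident (x : nat) (e : nat * nat * bool) : bool := (x == e.1.1) || (x == e.1.2).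

(** With ordered endpoints a set of two vertices determines its pair, so distinct pairs are distinct
    edges. *)
Definition simple_edges (nv : nat) (es : seq (nat * nat * bool)) : Prop :=
  all (fun e => e.1.1 < e.1.2 < nv) es /\ uniq [seq e.1 | e <- es].

Section ListInstance.
Variables (nv : nat) (es : seq (nat * nat * bool)) (k : nat).
Hypotheses (nv_gt0 : 0 < nv) (k_gt0 : 0 < k) (es_simple : simple_edges nv es).

Let es_bound e : e \in es -> e.1.1 < e.1.2 < nv.
Proof. by case: es_simple => /allP h _; exact: h. Qed.

Lemma edge_setP e x : e \in es -> x < nv -> (inord x \in edge_set nv e) = incident x e.
Proof.
case/es_bound/andP=> h1 h2 hx; rewrite !inE /incident -!val_eqE /= !inordK // prednK //; exact: ltn_trans h2.
Qed.

Lemma edge_set_inj : {in es &, injective (edge_set nv)}.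
Proof.
move=> e e' he he' eq; case: es_simple => _ hu.
have b := es_bound he; have b' := es_bound he'.
suff ee : e.1 = e'.1.
  case/(nthP e): he => i li ei; case/(nthP e): he' => j lj ej.
  move: ee; rewrite -ei -ej -!(nth_map e (fst e)) //.
  by move/eqP; rewrite nth_uniq ?size_map // => /eqP ->.
have h x : x < nv -> incident x e = incident x e'.
  by move=> hx; rewrite -!edge_setP // eq.
have h1 := h e.1.1; have h2 := h e.1.2; have h3 := h e'.1.1; have h4 := h e'.1.2.
move: h1 h2 h3 h4; rewrite /incident; case: e b {he eq h} => [[a c] r] /= b.
case: e' b' {he'} => [[a' c'] r'] /= b'; rewrite !eqxx /= ?orbT => h1 h2 h3 h4.
have h1' := h1 ltac:(lia); have h2' := h2 ltac:(lia).
have h3' := h3 ltac:(lia); have h4' := h4 ltac:(lia).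
have {}b : a < c < nv := b; have {}b' : a' < c' < nv := b'.
case/esym/orP: h1' => /eqP; case/esym/orP: h2' => /eqP; case/orP: h3' => /eqP; case/orP: h4' => /eqP; move=> *; congr pair; lia.
Qed.

Lemma card_edge_set e : e \in es -> #|edge_set nv e| = 2.
Proof.
case/es_bound/andP=> h1 h2; rewrite cards2 -val_eqE /= !inordK ?prednK //; last exact: ltn_trans h2.
by rewrite ltn_eqF.
Qed.

Lemma mem_list_edges e : e \in es -> edge_set nv e \in list_edges nv es.
Proof. by move=> he; rewrite inE map_f // card_edge_set. Qed.

Lemma list_edgesP s : reflect (exists2 e, e \in es & s = edge_set nv e) (s \in list_edges nv es).
Proof.
apply: (iffP idP) => [|[e he ->]]; last exact: mem_list_edges.
by rewrite inE => /andP [/mapP].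
Qed.

Lemma mem_list_red e : e \in es -> (edge_set nv e \in list_red nv es) = e.2.
Proof.
move=> he; rewrite inE mem_list_edges //=; apply/mapP/idP => [[e']|e2].
  by rewrite mem_filter => /andP [e2 he'] /(edge_set_inj he he') ->.
by exists e => //; rewrite mem_filter e2.
Qed.

Lemma uniq_edge_sets : uniq [seq edge_set nv e | e <- es].
Proof.
rewrite map_inj_in_uniq; last exact: edge_set_inj.
by case: es_simple => _; apply: map_uniq.
Qed.

Lemma card_list_edges : #|list_edges nv es| = size es.
Proof.
rewrite -(size_map (edge_set nv)) -(card_uniqP uniq_edge_sets).
apply: eq_card => s; apply/list_edgesP/mapP => -[e]; by exists e.
Qed.

Lemma list_instance_code :
  em_code (list_instance nv es k) ([:: nv; size es; k] ++ flat es).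
Proof.
exists [seq (inord e.1.1, inord e.1.2) | e <- es] => /=; split.
- by rewrite -map_comp; exact: uniq_edge_sets.
- move=> s; rewrite -map_comp; apply/mapP/list_edgesP => -[e]; by exists e.
- rewrite size_map (prednK k_gt0) -[in LHS](prednK nv_gt0); congr [:: _, _, _ & flatten _].
  rewrite -map_comp; apply/eq_in_map => e he /=.
  rewrite -/(edge_set nv e) mem_list_red // !inordK ?prednK //; case/andP: (es_bound he) => // h1 h2; exact: ltn_trans h2.
Qed.

(** Replaces sets of sets by a selection of list entries in which every vertex has degree 1; degrees
    and red counts are additive under concatenation of gadgets. *)
Lemma exact_matching_sel :
  exact_matching (list_instance nv es k) ->
  exists sel : pred (nat * nat * bool),
    (forall x, x < nv -> count (fun e => sel e && incident x e) es = 1) /\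
    count (fun e => sel e && e.2) es = k.
Proof.
case=> M [/= /subsetP sub part card].
have [covM trivM _] := and3P part.
exists (fun e => edge_set nv e \in M); split=> [x hx|].
  have xc : inord x \in cover M by rewrite (eqP covM) inE.
  have bM := pblock_mem xc.
  have /list_edgesP [e0 he0 eq0] := sub _ bM.
  rewrite -(@eq_in_count _ (pred1 e0)) => [|e he]; last first.
    rewrite -edge_setP //; apply/eqP/andP => [->|[h1 h2]].
      by rewrite -eq0 bM mem_pblock.
    by apply: edge_set_inj => //; rewrite -eq0 (def_pblock trivM h1 h2).
  rewrite count_uniq_mem ?he0 //; case: es_simple => _; exact: map_uniq.
rewrite -[RHS](prednK k_gt0) -card.
rewrite -size_filter -(size_map (edge_set nv)) -(@card_uniqP _ _ _); last first.
  rewrite map_inj_in_uniq ?filter_uniq //.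
    by case: es_simple => _; exact: map_uniq.
  by move=> e e'; rewrite !mem_filter => /andP [_ he] /andP [_ he']; exact: edge_set_inj.
apply: eq_card => s; rewrite in_setI; apply/mapP/andP => [[e]|[sM sr]].
  by rewrite mem_filter => /andP [/andP [h1 h2] he] ->; rewrite mem_list_red.
have /list_edgesP [e he eqs] := sub _ sM.
by exists e => //; rewrite mem_filter he -eqs sM andbT /= -mem_list_red // -eqs.
Qed.

Lemma exact_matching_list es' :
  {subset es' <= es} -> (forall x, x < nv -> count (incident x) es' = 1) ->
  count snd es' = k -> exact_matching (list_instance nv es k).
Proof.
move=> sub cnt cntr.
have xnv (x : 'I_nv.-1.+1) : x < nv by rewrite -[X in _ < X](prednK nv_gt0).
have one x e e' : x < nv -> e \in es' -> e' \in es' -> incident x e -> incident x e' -> e = e'.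
  move=> hx he he' ie ie'; have := cnt x hx; rewrite -size_filter.
  case E: [seq e <- es' | incident x e] => [|a [|b s]] //= _.
  have : e \in [seq e <- es' | incident x e] by rewrite mem_filter ie.
  have : e' \in [seq e <- es' | incident x e] by rewrite mem_filter ie'.
  by rewrite E !inE => /eqP -> /eqP ->.
(* An edge listed twice would give its smaller endpoint degree at least 2. *)
have uniq' : uniq es'.
  apply: count_mem_uniq => e; case he: (e \in es'); last by apply/count_memPn; rewrite he.
  have /andP [h1 h2] := es_bound (sub _ he).
  have lt1 : e.1.1 < nv by exact: ltn_trans h2.
  apply/eqP; rewrite eqn_leq; apply/andP; split.
    by rewrite -[X in _ <= X]/1 -(cnt _ lt1); apply: sub_count => x /= /eqP ->; rewrite /incident eqxx.
  by rewrite -has_count has_pred1.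
exists [set s | s \in [seq edge_set nv e | e <- es']]; split.
- apply/subsetP => s; rewrite inE => /mapP [e he ->]; exact/mem_list_edges/sub.
- apply/and3P; split.
  + rewrite eqEsubset subsetT /=; apply/subsetP => x _.
    have : has (incident x) es' by rewrite has_count cnt.
    case/hasP => e he ie; apply/bigcupP; exists (edge_set nv e).
      by rewrite inE map_f.
    by rewrite -[x]inord_val edge_setP // sub.
  + apply/trivIsetP => A B; rewrite !inE => /mapP [e he ->] /mapP [e' he' ->] ne.
    rewrite -setI_eq0; apply: contraNT ne => /set0Pn [x]; rewrite inE => /andP [].
    rewrite -[x]inord_val !edge_setP ?sub // => ie ie'.
    by rewrite (one x e e').
  + apply/negP; rewrite inE => /mapP [e he] /esym /eqP; apply/negP.
    by rewrite -card_gt0 card_edge_set // sub.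
rewrite -[RHS]/(k.-1.+1) (prednK k_gt0) -cntr.
rewrite -size_filter -(size_map (edge_set nv)) -(@card_uniqP _ _ _); last first.
  rewrite map_inj_in_uniq ?filter_uniq //.
  by move=> e e'; rewrite !mem_filter => /andP [_ /sub he] /andP [_ /sub he']; exact: edge_set_inj.
apply: eq_card => s; rewrite in_setI inE; apply/andP/mapP => [[/mapP [e he ->]]|[e]].
  by rewrite mem_list_red ?sub // => e2; exists e; rewrite // mem_filter e2.
by rewrite mem_filter => /andP [e2 he] ->; rewrite map_f ?mem_list_red ?sub.
Qed.

End ListInstance.

(** * Matchings along a single chain *)

Lemma links_front u z w : links u z w.+1 =
  (u, z, true) :: (z, z.+1, false) :: links z.+1 z.+2 w.
Proof.
elim: w => [|w IH]; first by rewrite /links /= muln0 addn0.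
rewrite links_S IH links_S /=; do 2 congr cons.
congr (rcons (rcons _ _) _).
  by congr (_, _, _); [case: w {IH} => [|w] /=|]; lia.
by congr (_, _, _); lia.
Qed.

Lemma prev_vertexS u z w : prev_vertex u z w.+1 = prev_vertex z.+1 z.+2 w.
Proof. by case: w => [|w] /=; lia. Qed.

(** The program extends a path at its far end, whereas a matching is followed from the slot on. The
    remaining chain starts at the inner vertex [z.+1], which is why the lemmas below allow starting
    vertices other than slots. *)
Lemma chainS m u w h z : chain m u w.+1 h z =
  (u, z, true) :: (z, z.+1, false) :: chain m z.+1 w h z.+2.
Proof. by rewrite /chain links_front prev_vertexS. Qed.

Lemma chain0 m u h z : chain m u 0 h z = finals m u h.
Proof. by []. Qed.

Lemma finalsP m p h e :
  reflect (exists2 j, j < h & e = (m + j, p, false)) (e \in finals m p h).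
Proof.
apply: (iffP mapP) => [[j]|[j jh ->]]; first by rewrite mem_iota => jh ->; exists j.
by exists j; rewrite ?mem_iota.
Qed.

Section Chain.
Variable m : nat.

(** For [w = 0] the edges lead from ranks directly to [u], which must then lie beyond the ranks for
    the endpoints to be in order. *)
Lemma chain_edge u w h z e : u < z -> m + m <= z -> h <= m -> (w = 0 -> m + m <= u) ->
  e \in chain m u w h z ->
  e.1.1 < e.1.2 /\ (if w == 0 then e.1.2 = u else z <= e.1.2 < z + 2 * w).
Proof.
elim: w u z => [|w IH] u z uz mz hm h0.
  by rewrite chain0 => /finalsP [j jh ->] /=; split=> //; have := h0 erefl; lia.
rewrite chainS !inE => /orP [/eqP ->|/orP [/eqP ->|he]] /=; try by split; lia.
have [|||h1] := IH z.+1 z.+2 _ _ hm _ he; try lia.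
by move: (e.1.1) (e.1.2) h1 => a b h1; case: w {IH h0 he} => [|w] /= h2; lia.
Qed.

Lemma chain_uniq u w h z : u < z -> m + m <= z -> h <= m -> (w = 0 -> m + m <= u) ->
  uniq [seq e.1 | e <- chain m u w h z].
Proof.
elim: w u z => [|w IH] u z uz mz hm h0.
  rewrite chain0 -map_comp map_inj_uniq ?iota_uniq // => i j [] /eqP.
  by rewrite eqn_add2l => /eqP.
have tail e : e \in chain m z.+1 w h z.+2 -> z < e.1.2 /\ (e.1.2 = z.+1 -> e.1.1 < m + m).
  case: w {IH h0} => [|w] he.
    by move: he; rewrite chain0 => /finalsP [j jh ->] /=; lia.
  have [//||//|_] := chain_edge _ _ hm _ he; first by lia.
  by case: e {he} => [[a b] r] /=; lia.
rewrite chainS /= inE negb_or IH ?andbT -?andbA; try lia; apply/and3P; split.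
- by apply/eqP => -[]; lia.
- by apply/mapP => -[e /tail [h1 h2] eq]; move: h1; rewrite -eq /= ltnn.
- by apply/mapP => -[e /tail [h1 h2] eq]; move: h2; rewrite -eq /= => /(_ erefl); lia.
Qed.

Lemma chain_incident u w h z e x : e \in chain m u w h z -> incident x e ->
  [\/ x = u, m <= x < m + h | z <= x < z + 2 * w].
Proof.
elim: w u z => [|w IH] u z.
  rewrite chain0 => /finalsP [j jh ->]; rewrite /incident /= => /orP [] /eqP ->.
    by apply: Or32; lia.
  by apply: Or31.
rewrite chainS !inE => /orP [/eqP ->|/orP [/eqP ->|/IH H /H []]].
- by rewrite /incident /= => /orP [] /eqP ->; [apply: Or31 | apply: Or33; lia].
- by rewrite /incident /= => /orP [] /eqP ->; apply: Or33; lia.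
- by move=> ->; apply: Or33; lia.
- by move=> h1; apply: Or32.
- by move=> h1; apply: Or33; lia.
Qed.

Lemma chain_count0 (sel : pred (nat * nat * bool)) u w h z x :
  x <> u -> ~ (m <= x < m + h) -> ~ (z <= x < z + 2 * w) ->
  count (fun e => sel e && incident x e) (chain m u w h z) = 0.
Proof.
move=> n1 n2 n3; apply/eqP; rewrite -leqn0 leqNgt -has_count; apply/hasP => -[e he].
by case/andP => _ /(chain_incident he) [].
Qed.

(* If every inner vertex is matched, then the link entering the chain
   determines all of its edges. *)
Lemma chain_sel (sel : pred (nat * nat * bool)) u w h z :
  u < z -> m + m <= z -> h <= m -> (u < m) || (m + m <= u) -> (w = 0 -> m + m <= u) ->
  (forall x, z <= x < z + 2 * w ->
     count (fun e => sel e && incident x e) (chain m u w h z) = 1) ->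
  let c x := count (fun e => sel e && incident x e) (chain m u w h z) in
  count (fun e => sel e && e.2) (chain m u w h z) = c u * w /\
  \sum_(j < m) c (m + j) = c u.
Proof.
elim: w u z => [|w IH] u z uz mz hm um h0 ok.
  have {}h0 := h0 erefl; rewrite chain0 /=; split.
    rewrite muln0; apply/eqP; rewrite -leqn0 leqNgt -has_count; apply/hasP.
    by case=> e /finalsP [j jh ->]; rewrite /= andbF.
  (* Double counting: every edge of [finals] meets [u] and exactly one rank. *)
  rewrite (eq_bigr (fun j : 'I_m => \sum_(e <- finals m u h) (sel e && (m + j == e.1.1)))); last first.
    move=> j _; rewrite -sum1_count big_mkcond /=; apply: eq_big_seq => e /finalsP [i ih ->].
    rewrite /incident /=; have -> : (m + j == u) = false by apply/eqP; have := ltn_ord j; lia.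
    by rewrite orbF; case: ifP.
  rewrite exchange_big -sum1_count [RHS]big_mkcond /=; apply: eq_big_seq => e /finalsP [i ih ->].
  rewrite /incident /= eqxx orbT andbT.
  have im : i < m by lia.
  rewrite (bigD1 (Ordinal im)) //= eqxx andbT big1 ?addn0; first by case: ifP.
  move=> j ne; rewrite eqn_add2l; have -> : (nat_of_ord j == i) = false.
    by apply: contraNF ne => /eqP eq; apply/eqP/val_inj.
  by rewrite andbF.
have c0 x : x <> z.+1 -> ~ (m <= x < m + h) -> ~ (z.+2 <= x < z.+2 + 2 * w) ->
  count (fun e => sel e && incident x e) (chain m z.+1 w h z.+2) = 0.
  exact: chain_count0.
have ok' x : z.+2 <= x < z.+2 + 2 * w ->
     count (fun e => sel e && incident x e) (chain m z.+1 w h z.+2) = 1.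
  move=> hx; have := ok x ltac:(lia); rewrite chainS /= /incident /=.
  have -> : (x == u) = false by lia.
  have -> : (x == z) = false by lia.
  have -> : (x == z.+1) = false by lia.
  by rewrite !andbF.
have [||||red fin] := IH z.+1 z.+2 _ _ hm _ _ ok'; try lia.
(* The vertex [z] has only the edges to [u] and [z.+1], and exactly one of them is selected. Hence
   [z.+1] is matched into the remaining chain exactly when [u] is matched to [z]. *)
have okz := ok z ltac:(lia); have okz1 := ok z.+1 ltac:(lia).
have iz1 : incident z (u, z, true) by rewrite /incident /= eqxx orbT.
have iz2 : incident z (z, z.+1, false) by rewrite /incident /= eqxx.
have iz3 : incident z.+1 (u, z, true) = false by rewrite /incident /=; lia.
have iz4 : incident z.+1 (z, z.+1, false) by rewrite /incident /= eqxx orbT.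
have iu1 : incident u (u, z, true) by rewrite /incident /= eqxx.
have iu2 : incident u (z, z.+1, false) = false by rewrite /incident /=; lia.
have eu : count (fun e => sel e && incident u e) (chain m z.+1 w h z.+2) = 0 by apply: c0; lia.
move: okz okz1; rewrite chainS /= iz1 iz2 iz3 iz4 iu1 iu2 (c0 z) ?eu; try lia.
rewrite !andbF !andbT !addn0 !add0n => e1 e2; split.
  by rewrite red; move: e1 e2; case: (sel _); case: (sel _) => /=; nia.
have -> : nat_of_bool (sel (u, z, true)) = count (fun e => sel e && incident z.+1 e) (chain m z.+1 w h z.+2) by lia.
rewrite -fin; apply: eq_bigr => j _; have := ltn_ord j => jm.
rewrite /= {1 2}/incident /=.
have -> : (m + j == u) = false by lia.
have -> : (m + j == z) = false by lia.
have -> : (m + j == z.+1) = false by lia.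
by rewrite !andbF.
Qed.

(** [on_chain] and [off_chain] are the two ways to match all inner vertices: with all red links,
    covering also [u] and the rank [j], or with the other links only. *)
Fixpoint on_chain (u w j z : nat) : seq (nat * nat * bool) :=
  if w is w'.+1 then (u, z, true) :: on_chain z.+1 w' j z.+2 else [:: (m + j, u, false)].

Fixpoint off_chain (w z : nat) : seq (nat * nat * bool) :=
  if w is w'.+1 then (z, z.+1, false) :: off_chain w' z.+2 else [::].

Lemma on_chain_sub u w h j z : j < h -> {subset on_chain u w j z <= chain m u w h z}.
Proof.
move=> jh; elim: w u z => [|w IH] u z e.
  by rewrite chain0 /= inE => /eqP ->; apply/finalsP; exists j.
by rewrite chainS /= !inE => /orP [-> // | /IH ->]; rewrite !orbT.
Qed.

Lemma off_chain_sub u w h z : {subset off_chain w z <= chain m u w h z}.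
Proof.
elim: w u z => [|w IH] u z e //.
by rewrite chainS /= !inE => /orP [-> | /IH ->]; rewrite !orbT.
Qed.

Lemma count_on_chain u w j z x :
  u < z -> m + m <= z -> j < m -> (u < m) || (m + m <= u) ->
  count (incident x) (on_chain u w j z) = (x == u) + (x == m + j) + (z <= x < z + 2 * w).
Proof.
elim: w u z => [|w IH] u z uz mz jm um /=.
  by rewrite /incident /=; case: eqP; case: eqP; lia.
by rewrite IH; try lia; rewrite /incident /=; case: (x =P u); case: (x =P z); case: (x =P z.+1); case: (x =P m + j); lia.
Qed.

Lemma count_off_chain w z x : count (incident x) (off_chain w z) = (z <= x < z + 2 * w).
Proof.
elim: w z => [|w IH] z /=; first by lia.
by rewrite IH /incident /=; case: (x =P z); case: (x =P z.+1); lia.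
Qed.

Lemma red_on_chain u w j z : count snd (on_chain u w j z) = w.
Proof. by elim: w u z => //= w IH u z; rewrite IH. Qed.

Lemma red_off_chain w z : count snd (off_chain w z) = 0.
Proof. by elim: w z => //= w IH z; rewrite IH. Qed.

End Chain.

(** * Matchings of a union of gadgets *)

Lemma sum_eq1_uniq (T : eqType) (s : seq T) (f : T -> nat) x y :
  \sum_(z <- s) f z = 1 -> x \in s -> y \in s -> 0 < f x -> 0 < f y -> x = y.
Proof.
move=> sum1 xs ys fx fy; apply/eqP; apply: contraT => ne.
have yr : y \in rem x s by apply: rem_mem => //; rewrite eq_sym.
by move: sum1; rewrite (big_rem x xs) (big_rem y yr) /=; lia.
Qed.

Lemma sum_eq1_exists (T : eqType) (s : seq T) (f : T -> nat) :
  \sum_(z <- s) f z = 1 -> exists2 x, x \in s & f x = 1.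
Proof.
elim: s => [|a s IH]; rewrite ?big_nil ?big_cons //.
case fa: (f a) => [|k] h.
  by case: IH => [|x xs fx]; [lia | exists x; rewrite // inE xs orbT].
by exists a; rewrite ?inE ?eqxx //; lia.
Qed.

Lemma sum_eq1_weight (T : eqType) (s : seq T) (f g : T -> nat) x :
  \sum_(z <- s) f z = 1 -> x \in s -> 0 < f x -> \sum_(z <- s) f z * g z = g x.
Proof.
move=> sum1 xs fx; rewrite (big_rem x xs) /=.
move: sum1; rewrite (big_rem x xs) /= => sum1.
have /eqP := sum1; rewrite -(ltn_predK fx) addSn eqSS addn_eq0 => /andP [/eqP f0 /eqP r0].
have f1 : f x = 1 by rewrite -(ltn_predK fx) f0.
rewrite f1 mul1n big_seq big1 ?addn0 // => z zr.
by move: r0; rewrite (big_rem z zr) /=; case: (f z).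
Qed.

(** Records the first inner vertex of each gadget, so that sums over gadgets can refer to their
    chains. *)
Fixpoint placed (z : nat) (gs : seq (nat * nat * nat)) : seq (nat * nat * nat * nat) :=
  if gs is g :: gs' then (g, z) :: placed (z + 2 * g.1.2) gs' else [::].

Definition placed_chain (m : nat) (p : nat * nat * nat * nat) : seq (nat * nat * bool) :=
  chain m p.1.1.1 p.1.1.2 p.1.2 p.2.

Lemma edges_placed m z gs : edges m z gs = flatten [seq placed_chain m p | p <- placed z gs].
Proof. by elim: gs z => //= g gs IH z; rewrite IH. Qed.

Lemma map_fst_placed z gs : [seq p.1 | p <- placed z gs] = gs.
Proof. by elim: gs z => //= g gs IH z; rewrite IH. Qed.

Lemma placed_bound z gs p : p \in placed z gs ->
  z <= p.2 /\ p.2 + 2 * p.1.1.2 <= z + inner_vertices gs.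
Proof.
elim: gs z => // g gs IH z /=; rewrite inE /inner_vertices /= => /orP [/eqP -> /=|/IH [h1 h2]].
  by lia.
rewrite /inner_vertices in h2; move: (p.2) (p.1.1.2) h1 h2 => a b; lia.
Qed.

Section Gadgets.
Variables (m : nat) (gs : seq (nat * nat * nat)).
Hypothesis gs_ok : forall g : nat * nat * nat, g \in gs -> [/\ g.1.1 < m, 0 < g.1.2 & g.2 <= m].

Let nv := m + m + inner_vertices gs.
Let es := edges m (m + m) gs.

Lemma placed_ok z hs p : {subset hs <= gs} -> p \in placed z hs ->
  [/\ p.1.1.1 < m, 0 < p.1.1.2 & p.1.2 <= m].
Proof.
move=> sub hp; apply: gs_ok; apply: sub; rewrite -(map_fst_placed z hs).
exact: map_f.
Qed.

(** Since weights are positive, the larger endpoint of an edge is an inner vertex of its own chain;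
    this separates the chains. *)
Lemma edges_simple z hs : {subset hs <= gs} -> m + m <= z ->
  [/\ all (fun e => e.1.1 < e.1.2 < z + inner_vertices hs) (edges m z hs),
      all (fun e => z <= e.1.2) (edges m z hs) & uniq [seq e.1 | e <- edges m z hs]].
Proof.
elim: hs z => // [[[u w] h]] hs IH z sub mz.
have [/= u_m w0 hm] := gs_ok (sub _ (mem_head _ _)).
have sub' : {subset hs <= gs} by move=> g hg; apply: sub; rewrite inE hg orbT.
have [/allP b1 /allP b2 un] := IH (z + 2 * w) sub' ltac:(lia).
have ce e : e \in chain m u w h z -> e.1.1 < e.1.2 /\ z <= e.1.2 < z + 2 * w.
  move=> he; have := @chain_edge m u w h z e ltac:(lia) mz hm ltac:(lia) he.
  by case: (w =P 0) => [e0|_]; [lia | move: (e.1.1) (e.1.2) => a b; lia].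
have -> : inner_vertices ((u, w, h) :: hs) = 2 * w + inner_vertices hs.
  by rewrite -cat1s inner_vertices_cat inner_vertices1.
rewrite /= map_cat cat_uniq un chain_uniq //; try lia; split.
- apply/allP => e; rewrite mem_cat => /orP [/ce|/b1].
    by case: e => [[a b] r] /=; lia.
  by rewrite addnA.
- apply/allP => e; rewrite mem_cat => /orP [/ce|/b2]; case: e => [[a b] r] /=; lia.
- rewrite andbT; apply/hasP => -[x /mapP [e he ->] /mapP [e' /ce he' eq]].
  have := b2 _ he; rewrite eq; case: e' he' {eq} => [[a b] r] /=; lia.
Qed.

Lemma es_simple : simple_edges nv es.
Proof. by case: (@edges_simple (m + m) gs) => // a _ b; split. Qed.

Lemma edges_incident z hs e x : {subset hs <= gs} -> e \in edges m z hs ->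
  incident x e -> (x < m + m) || (z <= x < z + inner_vertices hs).
Proof.
move=> sub; rewrite edges_placed => /flatten_mapP [p hp he] hx.
have [h1 h2] := placed_bound hp.
have [h3 _ h4] := placed_ok sub hp.
have := chain_incident he hx; move: (p.1.1.1) (p.1.1.2) (p.1.2) (p.2) h1 h2 h3 h4 => a b c d ? ? ? ?.
by case; lia.
Qed.

Lemma count_inner (sel : pred (nat * nat * bool)) z hs p x : {subset hs <= gs} -> m + m <= z ->
  p \in placed z hs -> p.2 <= x < p.2 + 2 * p.1.1.2 ->
  count (fun e => sel e && incident x e) (edges m z hs) =
  count (fun e => sel e && incident x e) (placed_chain m p).
Proof.
move=> + + hp hx; elim: hs z hp => // [[[u w] h]] hs IH z hp sub mz.
have sub' : {subset hs <= gs} by move=> g hg; apply: sub; rewrite inE hg orbT.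
have [/= u_m w0 hm] := gs_ok (sub _ (mem_head _ _)).
move: hp; rewrite /= inE => /orP [/eqP eqp|hp]; rewrite count_cat.
  have -> : count (fun e => sel e && incident x e) (edges m (z + 2 * w) hs) = 0.
    apply/eqP; rewrite -leqn0 leqNgt -has_count; apply/hasP => -[e he /andP [_ hxe]].
    by have := edges_incident sub' he hxe; move: hx; rewrite eqp /=; lia.
  by rewrite addn0 eqp.
rewrite (IH _ hp) //; last by lia.
have [b1 b2] := placed_bound hp.
by rewrite chain_count0 //; move: (p.2) (p.1.1.2) b1 b2 hx => a b; lia.
Qed.

Lemma count_edges (a : pred (nat * nat * bool)) z hs :
  count a (edges m z hs) = \sum_(p <- placed z hs) count a (placed_chain m p).
Proof. by rewrite edges_placed count_flatten sumnE !big_map. Qed.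

(** [G i] is the gadget into which slot [i] is matched, and [J i] is the rank at the other end of
    its path. *)
Lemma matching_choice k : 0 < m -> 0 < k ->
  exact_matching (list_instance nv es k) ->
  exists (G : 'I_m -> nat * nat * nat) (J : 'I_m -> 'I_m),
    [/\ forall i, [/\ G i \in gs, (G i).1.1 = i & J i < (G i).2],
        injective J & \sum_i (G i).1.2 = k].
Proof.
move=> m0 k0 em; have nv0 : 0 < nv by rewrite /nv; lia.
have [sel [cnt red]] := exact_matching_sel nv0 k0 es_simple em.
set P := placed (m + m) gs.
pose c x (p : nat * nat * nat * nat) := count (fun e => sel e && incident x e) (placed_chain m p).
pose cu p := c p.1.1.1 p.
have okP p : p \in P -> [/\ p.1.1.1 < m, 0 < p.1.1.2 & p.1.2 <= m].
  exact: placed_ok.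
have cs p : p \in P ->
  count (fun e => sel e && e.2) (placed_chain m p) = cu p * p.1.1.2 /\
  \sum_(j < m) c (m + j) p = cu p.
  move=> hp; have [u_m w0 hm] := okP p hp.
  have [b1 b2] := placed_bound hp.
  apply: chain_sel => //; first by [move: (p.1.1.1) (p.2) u_m b1 => a b; lia];
    [by rewrite u_m | by move=> e; rewrite e in w0 | ].
  move=> x hx; rewrite -/(placed_chain m p) -(count_inner sel _ _ hp hx) //; apply: cnt.
  by move: (p.2) (p.1.1.2) b1 b2 hx => a b; rewrite /nv; lia.
have cntP x : x < nv -> \sum_(p <- P) c x p = 1 by move=> hx; rewrite -count_edges; apply: cnt.
have cui (i : 'I_m) : \sum_(p <- P) (p.1.1.1 == i) * cu p = 1.
  rewrite -(cntP i); last by rewrite /nv; have := ltn_ord i; lia.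
  apply: eq_big_seq => p hp; rewrite /cu; case: eqP => [->|ne]; first by rewrite mul1n.
  have [b1 b2] := placed_bound hp; have := ltn_ord i => li.
  rewrite mul0n /c chain_count0 //; first by move/esym.
    by move: (p.1.2) => a; lia.
  by move: (p.2) (p.1.1.2) b1 => a b; lia.
pose ok (i : 'I_m) (pj : (nat * nat * nat * nat) * 'I_m) :=
   [/\ pj.1 \in P, pj.1.1.1.1 = i, cu pj.1 = 1 & 0 < c (m + pj.2) pj.1].
have ex (i : 'I_m) : exists pj, ok i pj.
  have [p hp] := sum_eq1_exists (cui i); case: eqP => // ui; rewrite mul1n => cp.
  have [_] := cs p hp; rewrite cp => /sum_eq1_exists [j _ hj].
  by exists (p, j); split=> //=; rewrite hj.
have [pj pjP] := @fin_all_exists _ (fun=> ((nat * nat * nat * nat) * 'I_m)%type) ok ex.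
have Jlt i : (pj i).2 < (pj i).1.1.2.
  have [hp ui cp cj] := pjP i; rewrite ltnNge; apply/negP => le.
  have [b1 b2] := placed_bound hp; have [u_m _ _] := okP _ hp.
  have lj := ltn_ord (pj i).2.
  move: cj; rewrite /c chain_count0 //.
  - by move: ((pj i).1.1.1.1) u_m => a; lia.
  - by move: ((pj i).1.1.2) le => a; lia.
  - by move: ((pj i).1.2) ((pj i).1.1.1.2) b1 => a b; lia.
exists (fun i => (pj i).1.1), (fun i => (pj i).2); split.
- move=> i; have [hp ui _ _] := pjP i; split=> //.
  by rewrite -(map_fst_placed (m + m) gs); apply: map_f.
(* The common rank has degree 1, so both slots use the same gadget, and a gadget belongs to one
   slot. *)
- move=> i i' eqJ; have [hp ui _ cj] := pjP i; have [hp' ui' _ cj'] := pjP i'.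
  apply: val_inj; rewrite /= -ui -ui'; congr (_.1.1.1).
  apply: (sum_eq1_uniq (cntP (m + (pj i).2) _)) => //; last by rewrite eqJ.
  by rewrite /nv; have := ltn_ord (pj i).2; lia.
- rewrite -red count_edges (eq_big_seq (fun p : nat * nat * nat * nat => \sum_(i < m) (p.1.1.1 == i :> nat) * cu p * p.1.1.2)).
    rewrite exchange_big; apply: eq_bigr => i _ /=.
    have [hp ui cp _] := pjP i.
    by rewrite (sum_eq1_weight (fun p => p.1.1.2) (cui i) hp) // ui eqxx cp.
  move=> p hp; have [-> _] := cs p hp; have [u_m _ _] := okP _ hp.
  rewrite (bigD1 (Ordinal u_m)) //= eqxx mul1n big1 ?addn0 // => i ne.
  have -> : (p.1.1.1 == i) = false by apply: contraNF ne => /eqP e; apply/eqP/val_inj; rewrite /= e.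
  by rewrite !mul0n.
Qed.

Lemma choice_matching k (G : 'I_m -> nat * nat * nat) (J : 'I_m -> 'I_m) :
  0 < m -> 0 < k -> uniq gs ->
  (forall i, [/\ G i \in gs, (G i).1.1 = i & J i < (G i).2]) ->
  injective J -> \sum_i (G i).1.2 = k -> exact_matching (list_instance nv es k).
Proof.
move=> m0 k0 gs_uniq GP Jinj sumk; have nv0 : 0 < nv by rewrite /nv; lia.
have Ginj : injective G.
  move=> i i' e; have [_ e1 _] := GP i; have [_ e2 _] := GP i'.
  by apply: val_inj; rewrite /= -e1 -e2 e.
pose owner g := [pick i | G i == g].
have ownerP g i : (owner g = Some i) <-> G i = g.
  rewrite /owner; case: pickP => [i' /eqP <-|none]; split=> //.
  - by case=> ->.
  - by move/Ginj=> ->.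
  - by move=> e; have := none i; rewrite e eqxx.
pose selected (p : nat * nat * nat * nat) :=
  if owner p.1 is Some i then on_chain m p.1.1.1 p.1.1.2 (J i) p.2 else off_chain p.1.1.2 p.2.
set P := placed (m + m) gs.
have okP p : p \in P -> [/\ p.1.1.1 < m, 0 < p.1.1.2 & p.1.2 <= m].
  exact: placed_ok.
pose hit x p := if owner p is Some i then (x == p.1.1) + (x == m + J i) else 0.
have cntp x p : p \in P -> count (incident x) (selected p) = hit x p.1 + (p.2 <= x < p.2 + 2 * p.1.1.2).
  move=> hp; rewrite /selected /hit; case: (owner p.1) => [i|]; last exact: count_off_chain.
  have [u_m _ _] := okP _ hp; have [b1 _] := placed_bound hp.
  by rewrite count_on_chain ?u_m //; apply: leq_trans b1; apply: leq_trans u_m (leq_addr _ _).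
have blocks z hs x : \sum_(p <- placed z hs) (p.2 <= x < p.2 + 2 * p.1.1.2) = (z <= x < z + inner_vertices hs).
  elim: hs z => [|[[u w] h] hs IH] z; first by rewrite big_nil /inner_vertices /= muln0; lia.
  rewrite /= big_cons IH /= -[in RHS]cat1s inner_vertices_cat inner_vertices1; lia.
have cnt_gs (f : nat * nat * nat -> nat) : \sum_(p <- P) f p.1 = \sum_(g <- gs) f g.
  by rewrite -[in RHS](map_fst_placed (m + m) gs) big_map.
have count_G i : \sum_(g <- gs) (g == G i) = 1.
  have [Gi _ _] := GP i.
  by rewrite -(@eq_bigr _ _ _ _ _ xpredT (fun g => if pred1 (G i) g then 1 else 0)) -?big_mkcond ?sum1_count ?count_uniq_mem ?Gi.
apply: (@exact_matching_list nv es k nv0 k0 es_simple (flatten [seq selected p | p <- P])).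
- move=> e /flatten_mapP [p hp]; rewrite /es edges_placed => he; apply/flatten_mapP; exists p => //.
  move: he; rewrite /selected; case E: (owner p.1) => [i|]; last exact: off_chain_sub.
  by apply: on_chain_sub; case: (GP i) => _ _; move/ownerP: E => ->.
- move=> x hx; rewrite count_flatten sumnE !big_map.
  rewrite (eq_big_seq _ (fun p hp => cntp x p hp)) big_split /= blocks cnt_gs.
  (* A slot is covered by its own path only, and a rank by the path of its preimage under [J], which
     is onto as an injection of a finite type into itself. An inner vertex is covered once within
     its chain. *)
  case: (ltnP x m) => xm.
    have -> : (m + m <= x < m + m + inner_vertices gs) = false by lia.
    rewrite addn0 -(count_G (Ordinal xm)); apply: eq_bigr => g _; rewrite /hit.
    case E: (owner g) => [i|]; last first.
      by case: eqP => // e; have /ownerP := esym e; rewrite E.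
    move/ownerP: E => <-; rewrite (inj_eq Ginj) -val_eqE /=; case: (GP i) => _ -> _.
    by rewrite eq_sym; have := ltn_ord (J i); lia.
  case: (ltnP x (m + m)) => xmm.
    have xj : x - m < m by lia.
    pose i0 := invF Jinj (Ordinal xj).
    have Ji0 : J i0 = x - m :> nat by rewrite /i0 f_invF.
    rewrite /= addn0 -(count_G i0); apply: eq_bigr => g _; rewrite /hit.
    case E: (owner g) => [i|]; last first.
      by case: eqP => // e; have /ownerP := esym e; rewrite E.
    move/ownerP: E => <-; rewrite (inj_eq Ginj) -(inj_eq Jinj) -val_eqE /= Ji0; case: (GP i) => _ -> _.
    by have := ltn_ord i; lia.
  rewrite big1 => [|g _]; first by move: hx; rewrite /nv; lia.
  rewrite /hit; case E: (owner g) => [i|//].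
  move/ownerP: E => <-; case: (GP i) => _ -> _.
  by have := ltn_ord i; have := ltn_ord (J i); lia.
- rewrite count_flatten sumnE !big_map -sumk.
  rewrite (eq_bigr (fun p => if owner p.1 is Some i then p.1.1.2 else 0)); last first.
    by move=> p _; rewrite /selected; case: (owner p.1) => [i|]; rewrite ?red_on_chain ?red_off_chain.
  rewrite (cnt_gs (fun g => if owner g is Some i then g.1.2 else 0)).
  rewrite (eq_bigr (fun g => \sum_(i < m) (g == G i) * g.1.2)); last first.
    move=> g _; case E: (owner g) => [i|].
      move/ownerP: E => <-; rewrite (bigD1 i) //= eqxx mul1n big1 ?addn0 // => i' ne.
      by rewrite (inj_eq Ginj) eq_sym (negbTE ne).
    rewrite big1 // => i _; case: eqP => // e.
    by have /ownerP := esym e; rewrite E.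
  rewrite exchange_big; apply: eq_bigr => i _ /=; have [Gi _ _] := GP i.
  by rewrite (sum_eq1_weight (fun g => g.1.2) (count_G i) Gi) // eqxx.
Qed.

End Gadgets.

(** * Schedules and slots *)

Lemma uniq_bounded_size (s : seq nat) k : uniq s -> {in s, forall x, x < k} -> size s <= k.
Proof.
move=> us hs; rewrite -(size_iota 0 k); apply: uniq_leq_size => // x /hs.
by rewrite mem_iota.
Qed.

(* Serving the tasks in the order of their thresholds [F] is optimal. *)
Lemma hall_threshold (F : nat -> nat) m :
  (forall k, count (fun i => F i <= k) (iota 0 m) <= k) ->
  exists2 rho : nat -> nat, {in [pred i | i < m] &, injective rho} &
    forall i, i < m -> rho i < m /\ rho i < F i.
Proof.
move=> hall; pose s := sort (relpre F leq) (iota 0 m).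
have perm_s : perm_eq s (iota 0 m) by rewrite perm_sort.
have mem_s i : i < m -> i \in s by move=> im; rewrite (perm_mem perm_s) mem_iota.
have size_s : size s = m by rewrite (perm_size perm_s) size_iota.
have sorted_s : sorted (relpre F leq) s.
  by apply: sort_sorted => i j; apply: leq_total.
exists (fun i => index i s).
  move=> i j; rewrite !inE => im jm e.
  by rewrite -(nth_index 0 (mem_s i im)) e nth_index ?mem_s.
move=> i im; have lt : index i s < size s by rewrite index_mem mem_s.
split; first by rewrite -size_s.
(* Otherwise all tasks up to [i] in sorted order have thresholds at most [index i s], and there is
   one too many of them. *)
rewrite ltnNge; apply/negP => le; have := hall (index i s); rewrite leqNgt => /negP; apply.
rewrite -(permP perm_s) -[in X in _ < count _ X](cat_take_drop (index i s).+1 s) count_cat.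
apply: leq_trans (leq_addr _ _); rewrite -[X in X <= _](@size_takel (index i s).+1 _ s) //.
suff /eqP -> : count (fun l => F l <= index i s) (take (index i s).+1 s) == size (take (index i s).+1 s) by [].
rewrite -all_count; apply/(all_nthP 0) => j; rewrite size_takel // => lej; rewrite nth_take //.
apply: leq_trans le; rewrite -[in X in _ <= F X](nth_index 0 (mem_s i im)).
apply: (@sorted_leq_nth _ (relpre F leq) _ _ 0 s sorted_s) => //.
- by move=> a b c /=; apply: leq_trans.
- by move=> a /=.
- by rewrite inE; apply: leq_ltn_trans lt.
Qed.

(* [f i] and [g i] are the positions of the two visits of [i]; [f i < g i] is
   not required. *)
Definition visits (n : nat) (d f g : nat -> nat) : Prop :=
  [/\ forall i, i < n -> 0 < f i <= d i,
      forall i, i < n -> 0 < g i <= f i + d i,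
      {in [pred i | i < n] &, injective f},
      {in [pred i | i < n] &, injective g} &
      forall i j, i < n -> j < n -> f i <> g j].

Lemma visits_perm n d d' f g : perm_eq (mkseq d' n) (mkseq d n) ->
  visits n d f g -> exists f' g', visits n d' f' g'.
Proof.
move=> /(perm_iotaP 0) [Is]; rewrite size_mkseq => pIs eqd [h1 h2 h3 h4 h5].
have sIs : size Is = n by rewrite (perm_size pIs) size_iota.
pose s i := nth 0 Is i.
have sn i : i < n -> s i < n.
  move=> lt; have : s i \in Is by apply: mem_nth; rewrite sIs.
  by rewrite (perm_mem pIs) mem_iota.
have sinj : {in [pred i | i < n] &, injective s}.
  move=> i j; rewrite !inE => ilt jlt /eqP.
  by rewrite nth_uniq ?sIs ?(perm_uniq pIs) ?iota_uniq // => /eqP.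
have ds i : i < n -> d' i = d (s i).
  move=> lt; have := congr1 (fun t => nth 0 t i) eqd.
  by rewrite nth_mkseq // (nth_map 0) ?sIs // nth_mkseq ?sn.
exists (f \o s), (g \o s); split=> [i lt|i lt|i j il jl /= e|i j il jl /= e|i j il jl] /=.
- by rewrite ds // h1 ?sn.
- by rewrite ds // h2 ?sn.
- by apply: sinj => //; apply: h3; rewrite ?inE ?sn.
- by apply: sinj => //; apply: h4; rewrite ?inE ?sn.
- by apply: h5; rewrite sn.
Qed.

(** * First visits on the discretized sequence, second visits on free positions *)

Section Alpha.
Variables (d : nat -> nat) (n : nat).
Hypotheses (n_gt0 : 0 < n) (d_gt0 : forall i, i < n -> 0 < d i)
  (d_mono : forall i j, i <= j < n -> d i <= d j).
Let al := alpha d n.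

Lemma alpha_top : al n = d n.-1 + n + 1.
Proof. by rewrite /al /alpha subnn. Qed.

Lemma alpha_step r : r < n -> al r = minn (al r.+1).-1 (d r + n).
Proof.
move=> rn; rewrite /al /alpha; have -> : n - r = (n - r.+1).+1 by lia.
by rewrite /=; have -> : n - (n - r.+1).+1 = r by lia.
Qed.

(** An entry is one below the next entry or at least n + 1. In particular the truncated predecessor
    in [alpha_down] never truncates. *)
Lemma alpha_gt r : r <= n -> r < al r.
Proof.
move=> rn; have -> : r = n - (n - r) by lia.
elim: (n - r) => [|k IH]; first by rewrite subn0 alpha_top; lia.
case: (leqP n k) => kn; first by have -> : n - k.+1 = n - k by lia.
rewrite alpha_step; last by lia.
have -> : (n - k.+1).+1 = n - k by lia.
by have := d_gt0 (i := n - k.+1) ltac:(lia); lia.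
Qed.

Lemma alpha_le r : r < n -> al r <= d r + n.
Proof. by move=> rn; rewrite alpha_step // geq_minr. Qed.

Lemma alpha_lt r : r < n -> al r < al r.+1.
Proof. by move=> rn; have := alpha_gt rn; rewrite (alpha_step rn); lia. Qed.

Lemma alpha_ltn r s : r < s -> s < n -> al r < al s.
Proof.
elim: s => // s IH; rewrite ltnS leq_eqVlt => /orP [/eqP -> |rs] sn.
  by apply: alpha_lt; lia.
by have := IH rs (ltnW sn); have := alpha_lt (ltnW sn); lia.
Qed.

Lemma alpha_inj : {in [pred i | i < n] &, injective al}.
Proof.
move=> r s; rewrite !inE => rn sn e; case: (ltngtP r s) => // lt.
  by have := alpha_ltn lt sn; lia.
by have := alpha_ltn lt rn; lia.
Qed.

(** Going up from [r], the entries rise by 1 until one of them equals its deadline; the sentinel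
    guarantees this at the last entry at the latest. *)
Lemma alpha_tight r : r < n ->
  exists e, [/\ r <= e < n, al e = d e + n & al e = al r + (e - r)].
Proof.
move=> rn; have [k hk] : exists k, n - r = k.+1 by exists (n - r).-1; lia.
elim: k r rn hk => [|k IH] r rn hk.
  exists r; split; [lia | | lia].
  have e1 : r.+1 = n by lia.
  have e2 : n.-1 = r by lia.
  by have := alpha_top; have := alpha_step rn; rewrite e1 e2; lia.
have [e [h1 h2 h3]] := IH r.+1 ltac:(lia) ltac:(lia).
have := alpha_step rn; have := alpha_gt (r := r.+1) ltac:(lia).
case: (leqP (al r.+1).-1 (d r + n)) => le hgt st.
  by exists e; split; lia.
by exists r; split; lia.
Qed.

(* A slot [al r] that is not used for a first visit is too late for one of
   the tasks r, ..., e, which then moves there. *)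
Lemma visits_raise f g r : visits n d f g -> r < n ->
  (forall t, t < n -> f t + n <> al r) ->
  exists f' g', visits n d f' g' /\ \sum_(i < n) f i < \sum_(i < n) f' i.
Proof.
move=> [h1 h2 h3 h4 h5] rn bad.
have [e [re te ae]] := alpha_tight rn.
(* Pigeonhole: otherwise e - r + 1 distinct first visits lie strictly after [al r] and, by their
   deadlines, not after [al e], where there are only e - r positions. *)
have [t] : exists t, r <= t <= e /\ f t + n < al r.
  have [/hasP [t]|/hasPn none] := boolP (has (fun t => f t + n < al r) (iota r (e - r).+1)).
    by rewrite mem_iota => ht lt; exists t; split=> //; lia.
  have big t : r <= t <= e -> al r < f t + n.
    move=> ht; have := none t; rewrite mem_iota => /(_ ltac:(lia)).
    by have := bad t ltac:(lia); lia.
  suff : (e - r).+1 <= e - r by lia.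
  rewrite -[X in X <= _](size_iota r) -(size_map (fun t => f t + n - (al r).+1)).
  apply: uniq_bounded_size => [|x /mapP [t]].
    rewrite map_inj_in_uniq ?iota_uniq // => t t'; rewrite !mem_iota => ht ht' eq.
    have b := big t ltac:(lia); have b' := big t' ltac:(lia).
    by apply: h3; rewrite ?inE; lia.
  rewrite mem_iota => ht ->; have b := big t ltac:(lia).
  have := h1 t ltac:(lia); have := d_mono (i := t) (j := e) ltac:(lia); lia.
case=> ht lt; have tn : t < n by lia.
set v := al r - n.
have ft := h1 t tn.
have vd : v <= d t.
  by have := alpha_le rn; have := d_mono (i := r) (j := t) ltac:(lia); rewrite /v; lia.
have fv : f t < v by rewrite /v; lia.
have vF x : x < n -> f x <> v by move=> /bad; rewrite /v; lia.
pose f' x := if x == t then v else f x.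
have ff' x : f x <= f' x by rewrite /f'; case: eqP => [->|]; lia.
have sum_lt : \sum_(i < n) f i < \sum_(i < n) f' i.
  rewrite (bigD1 (Ordinal tn)) //= [X in _ < X](bigD1 (Ordinal tn)) //= /f' eqxx.
  by rewrite -addSn; apply: leq_add => //; apply: leq_sum => i _; apply: ff'.
have f'inj : {in [pred i | i < n] &, injective f'}.
  move=> x y; rewrite !inE /f' => xn yn; case: (x =P t) => [->|nx]; case: (y =P t) => [->|ny] //.
  - by move/esym/(vF _ yn).
  - by move/(vF _ xn).
  - by move=> eq; apply: h3.
have f'd x : x < n -> 0 < f' x <= d x.
  by move=> xn; rewrite /f'; case: eqP => [->|_]; [lia | apply: h1].
(* If [v] carries the second visit of [u], that visit moves to the old position of [t]. This is
   earlier, so its bound still holds, even if it now precedes the first visit of [u]. *)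
have [/hasP [u]|/hasPn noG] := boolP (has (fun u => g u == v) (iota 0 n)).
  rewrite mem_iota /= => un /eqP gu.
  pose g' x := if x == u then f t else g x.
  exists f', g'; split=> //; split=> //.
  - move=> x xn; rewrite /g'; case: eqP => [->|_].
      have := h2 u un; have := ff' u; lia.
    have := h2 x xn; have := ff' x; lia.
  - move=> x y; rewrite !inE /g' => xn yn; case: (x =P u) => [->|nx]; case: (y =P u) => [->|ny] //.
    + by move/(h5 t y tn yn).
    + by move/esym/(h5 t x tn xn).
    + by move=> eq; apply: h4.
  - move=> x y xn yn; rewrite /f' /g'; case: (x =P t) => [_|nx]; case: (y =P u) => [_|ny].
    + by lia.
    + by rewrite -gu => /(h4 u y un yn) /esym.
    + by move=> eq; apply: nx; apply: h3.
    + exact: h5.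
exists f', g; split=> //; split=> //.
  move=> x xn; have := h2 x xn; have := ff' x; lia.
move=> x y xn yn; rewrite /f'; case: (x =P t) => [_|_]; last exact: h5.
by have := noG y; rewrite mem_iota => /(_ yn) /eqP ne e2; apply: ne.
Qed.

(** The sum of the first positions increases with every raise and is bounded by the sum of the
    deadlines, so raising terminates. *)
Lemma visits_first_slots f g : visits n d f g ->
  exists f' g', visits n d f' g' /\ forall r, r < n -> exists2 t, t < n & f' t + n = al r.
Proof.
move: {2}(_ - _) (leqnn (\sum_(i < n) d i - \sum_(i < n) f i)) => k.
elim: k f g => [|k IH] f g le V.
all: have [/allP ok|/allPn [r]] := boolP (all (fun r => has (fun t => f t + n == al r) (iota 0 n)) (iota 0 n)).
1,3: exists f, g; split=> // r rn; have := ok r; rewrite mem_iota => /(_ rn) /hasP [t];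
  rewrite mem_iota => tn /eqP; by exists t.
all: rewrite mem_iota => /= rn /hasPn none.
all: have [|f' [g' [V' lt]]] := @visits_raise f g r V rn; first by
   move=> t tn /eqP; apply/negP/none; rewrite mem_iota.
all: have le' : \sum_(i < n) f' i <= \sum_(i < n) d i by
   apply: leq_sum => i _; case: V' => h _ _ _ _; case/andP: (h i (ltn_ord i)).
  by lia.
by apply: (IH f' g') => //; lia.
Qed.

(* The number of free positions among 1, ..., [v]. *)
Definition free_rank (v : nat) : nat := v - rank_count n al (v + n).

(* [x i] is the deadline given to slot [i]. By [hall_threshold], the second
   condition says that the second visits fit into the free positions. *)
Definition placeable (x : nat -> nat) : Prop :=
  (forall i, i < n -> n < al i <= x i + n) /\
  forall k, count (fun i => free_rank (al i - n + x i) <= k) (iota 0 n) <= k.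

Lemma rank_count_S X : rank_count n al X.+1 = rank_count n al X + count (fun l => al l == X.+1) (iota 0 n).
Proof.
rewrite /rank_count; elim: (iota 0 n) => //= l s ->.
by rewrite leq_eqVlt ltnS; case: eqP => [->|]; case: leqP; lia.
Qed.

Lemma rank_count_hit X : count (fun l => al l == X) (iota 0 n) <= 1.
Proof.
rewrite -size_filter -[X in _ <= X](size_map al [:: 0]) -[X in X <= _](size_map al).
apply: (@leq_trans (size [:: X])) => //; apply: uniq_leq_size => [|y /mapP [l]].
  rewrite map_inj_in_uniq ?filter_uniq ?iota_uniq // => i j.
  by rewrite !mem_filter !mem_iota => /andP [_ ii] /andP [_ jj]; apply: alpha_inj.
by rewrite mem_filter => /andP [/eqP -> _] ->; rewrite inE.
Qed.

Lemma free_rank_mono v w : v <= w -> free_rank v <= free_rank w.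
Proof.
elim: w => [|w IH]; first by rewrite leqn0 => /eqP ->.
rewrite leq_eqVlt => /orP [/eqP -> //|]; rewrite ltnS => /IH le; apply: leq_trans le _.
by rewrite /free_rank addSn rank_count_S; have := rank_count_hit (w + n).+1; lia.
Qed.

Section Positive.
Hypothesis al_pos : forall i, i < n -> n < al i.

Lemma rank_count_bound v : rank_count n al (v + n) <= v.
Proof.
elim: v => [|v IH].
  rewrite leqn0 /rank_count -leqn0 leqNgt -has_count; apply/hasP => -[l].
  by rewrite mem_iota => ln; have := al_pos ln; lia.
by rewrite addSn rank_count_S; have := rank_count_hit (v + n).+1; lia.
Qed.

Lemma free_rank_free v : 0 < v -> (forall l, l < n -> al l <> v + n) ->
  free_rank v = (free_rank v.-1).+1.
Proof.
case: v => // v _ hv; rewrite /free_rank addSn rank_count_S /=.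
have -> : count (fun l => al l == (v + n).+1) (iota 0 n) = 0.
  apply/eqP; rewrite -leqn0 leqNgt -has_count; apply/hasP => -[l].
  by rewrite mem_iota => ln /eqP; apply: hv.
by have := rank_count_bound v; lia.
Qed.

Lemma free_rank_taken v : 0 < v -> (exists2 l, l < n & al l = v + n) ->
  free_rank v <= free_rank v.-1.
Proof.
case: v => // v _ [l ln hl]; rewrite /free_rank addSn rank_count_S /=.
suff : 0 < count (fun l => al l == (v + n).+1) (iota 0 n) by lia.
by rewrite -has_count; apply/hasP; exists l; rewrite ?mem_iota //; apply/eqP.
Qed.

End Positive.

Lemma visits_placeable f g : visits n d f g ->
  (forall r, r < n -> exists2 t, t < n & f t + n = al r) ->
  exists2 x, perm_eq (mkseq x n) (mkseq d n) & placeable x.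
Proof.
move=> [h1 h2 h3 h4 h5] onto.
pose tau r := find (fun t => f t + n == al r) (iota 0 n).
have tauP r : r < n -> tau r < n /\ f (tau r) + n = al r.
  move=> rn; have [t tn ft] := onto r rn.
  have hs : has (fun t => f t + n == al r) (iota 0 n).
    by apply/hasP; exists t; rewrite ?mem_iota // ft.
  have lt : tau r < n by rewrite /tau -[X in _ < X](size_iota 0) -has_find.
  by split=> //; have /eqP := nth_find 0 hs; rewrite -/(tau r) nth_iota // add0n.
have tau_inj : {in [pred i | i < n] &, injective tau}.
  move=> r s; rewrite !inE => rn sn e; apply: alpha_inj; rewrite ?inE //.
  by have [_ <-] := tauP r rn; have [_ <-] := tauP s sn; rewrite e.
have al_pos i : i < n -> n < al i.
  by move=> lt; have [tn <-] := tauP i lt; have := h1 _ tn; lia.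
exists (d \o tau).
  have -> : mkseq (d \o tau) n = map d (mkseq tau n) by rewrite -map_comp.
  apply: perm_map; apply: uniq_perm; rewrite ?iota_uniq //.
    by rewrite map_inj_in_uniq ?iota_uniq // => r s; rewrite !mem_iota; apply: tau_inj.
  apply: (uniq_min_size _ _ _).2; rewrite ?size_mkseq ?size_iota //.
    by rewrite map_inj_in_uniq ?iota_uniq // => r s; rewrite !mem_iota; apply: tau_inj.
  by move=> x /mapP [r]; rewrite mem_iota => rn ->; rewrite mem_iota; have [] := tauP r rn.
split=> [i lt|k] /=.
  by rewrite al_pos //=; have [tn <-] := tauP i lt; have := h1 _ tn; lia.
(* Because of the predecessor this is the rank of the second visit counted from 0; these ranks are
   distinct, and those considered here are below [k]. *)
rewrite -size_filter -(size_map (fun r => free_rank (g (tau r)).-1)).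
have gfree r : r < n -> forall l, l < n -> al l <> g (tau r) + n.
  move=> rn l ln; have [tn _] := tauP r rn; have [tl <-] := tauP l ln.
  by have := h5 _ _ tl tn; lia.
have g0 r : r < n -> 0 < g (tau r).
  by move=> rn; have [tn _] := tauP r rn; case/andP: (h2 _ tn).
apply: uniq_bounded_size => [|y /mapP [r]].
  have lt r s : r < n -> s < n -> g (tau r) < g (tau s) ->
      free_rank (g (tau r)).-1 < free_rank (g (tau s)).-1.
    move=> rn sn lt; rewrite -(free_rank_free al_pos) //; [|exact: g0|exact: gfree].
    by apply: free_rank_mono; lia.
  rewrite map_inj_in_uniq ?filter_uniq ?iota_uniq // => r s.
  rewrite !mem_filter !mem_iota => /andP [_ rn] /andP [_ sn] e.
  apply: tau_inj; rewrite ?inE //; apply: h4; rewrite ?inE; try by case: (tauP _ rn); case: (tauP _ sn).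
  by case: (ltngtP (g (tau r)) (g (tau s))) => // l; have := lt _ _ _ _ l; rewrite e ltnn => /(_ ltac:(done) ltac:(done)).
rewrite mem_filter mem_iota => /andP [le rn] ->.
apply: leq_trans le; rewrite -(free_rank_free al_pos) //; [|exact: g0|exact: gfree].
apply: free_rank_mono; have [tn <-] := tauP r rn; have := h2 _ tn; lia.
Qed.

Lemma placeable_visits x : perm_eq (mkseq x n) (mkseq d n) -> placeable x ->
  exists f g, visits n d f g.
Proof.
move=> pxd [h1 h2].
have al_pos i : i < n -> n < al i by move=> /h1 /andP [].
have [rho rho_inj rhoP] := hall_threshold h2.
suff [g gP] : exists g : nat -> nat, forall i, i < n ->
   [/\ 0 < g i, g i <= al i - n + x i, free_rank (g i) = (rho i).+1 & forall l, l < n -> al l <> g i + n].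
  apply: (@visits_perm n x d (fun i => al i - n) g); first by rewrite perm_sym.
  split=> [i lt|i lt|i j|i j|i j il jl].
  - by have := h1 i lt; lia.
  - by have [] := gP i lt; lia.
  - rewrite !inE => il jl e; apply: alpha_inj; rewrite ?inE //.
    by have := al_pos i il; have := al_pos j jl; lia.
  - rewrite !inE => il jl e; apply: rho_inj; rewrite ?inE //.
    by have [_ _ e1 _] := gP i il; have [_ _ e2 _] := gP j jl; move: e1; rewrite e e2; lia.
  - by have [_ _ _ h] := gP j jl; have := h i il; have := al_pos i il; lia.
(* The first position whose free rank exceeds [rho i]. It is free itself, since the free rank does
   not grow at a taken position. *)
pose g i := find (fun v => rho i < free_rank v) (iota 0 (al i - n + x i).+1).
exists g => i lt; have [_ rlt] := rhoP i lt.
set b := al i - n + x i in rlt *.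
have hs : has (fun v => rho i < free_rank v) (iota 0 b.+1).
  by apply/hasP; exists b; rewrite ?mem_iota //; lia.
have gb : g i < b.+1 by rewrite /g -/b -[X in _ < X](size_iota 0) -has_find.
have gr : rho i < free_rank (g i).
  by have := nth_find 0 hs; rewrite nth_iota //.
have g0 : 0 < g i.
  by move: gr; case: (g i) => //; rewrite /free_rank sub0n.
have gl : free_rank (g i).-1 <= rho i.
  have lt' : (g i).-1 < g i by lia.
  have := @before_find _ 0 (fun v => rho i < free_rank v) (iota 0 b.+1) _ lt'.
  by rewrite nth_iota ?add0n; lia.
have gf l : l < n -> al l <> g i + n.
  move=> ln e; have := free_rank_taken g0 (ex_intro2 _ _ l ln e); lia.
split=> //; have := free_rank_free al_pos g0 gf; lia.
Qed.

End Alpha.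

(** * Schedules and the positions of their visits *)

Lemma mem_after_first (T : eqType) (s : seq T) (i : T) : count_mem i s = 2 ->
  i \in s /\ i \in drop (first_pos s i) s.
Proof.
move=> c2; have si : i \in s by rewrite -has_pred1 has_count c2.
split=> //; have := cat_take_drop (index i s) s.
rewrite (drop_nth i) ?index_mem // nth_index // => e.
have z : count_mem i (take (index i s) s) = 0.
  by apply/count_memPn; rewrite in_take // ltnn.
by move: c2; rewrite -{1}e count_cat z -has_pred1 has_count /first_pos /= eqxx => -[]; rewrite add0n => ->.
Qed.

Lemma gap_nth (T : eqType) (x0 : T) (s : seq T) (i : T) : count_mem i s = 2 ->
  nth x0 s (first_pos s i).-1 = i /\ nth x0 s (first_pos s i + gap s i).-1 = i.
Proof.
move=> /mem_after_first [si sd]; split; first exact: nth_index.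
by rewrite /gap addnS -pred_Sn -nth_drop nth_index.
Qed.

Lemma two_visits_visits D : two_visits D ->
  exists f g, visits (size D) (nth 0 D) f g.
Proof.
case=> s [_ sP]; set n := size D in s sP *.
pose F (h : 'I_n -> nat) i := if insub i is Some o then h o else 0.
have FE h (o : 'I_n) : F h o = h o by rewrite /F valK.
exists (F (first_pos s)), (F (fun o => first_pos s o + gap s o)).
have nf o : nth o s (first_pos s o).-1 = o by have [c _ _] := sP o; case: (gap_nth o c).
have ng o : nth o s (first_pos s o + gap s o).-1 = o by have [c _ _] := sP o; case: (gap_nth o c).
have lt o : (first_pos s o + gap s o).-1 < size s.
  rewrite ltnNge; apply/negP => le; have [c _ _] := sP o.
  have [_ so] := mem_after_first c.
  move: so le; rewrite -index_mem size_drop /gap /first_pos.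
  set a := index o (drop _ _); set b := index o s; set t := size s; move: a b t => a b t; lia.
have inj (u v : nat) (o o' : 'I_n) : nth o s u = o -> nth o' s v = o' -> u < size s -> u = v -> o = o'.
  by move=> e e' us uv; rewrite -e -e' -uv; apply: set_nth_default.
split.
- move=> i lti; rewrite -[i]/(val (Ordinal lti)) FE /=; have [_ h _] := sP (Ordinal lti).
  by rewrite h.
- move=> i lti; rewrite -[i]/(val (Ordinal lti)) !FE /=; have [_ _ h] := sP (Ordinal lti).
  by rewrite leq_add2l.
- move=> i j; rewrite !inE => lti ltj.
  rewrite -[i]/(val (Ordinal lti)) -[j]/(val (Ordinal ltj)) !FE => e.
  congr val; apply: (inj _ _ _ _ (nf _) (nf _)); last by rewrite e.
  by apply: leq_ltn_trans (lt (Ordinal lti)); rewrite /gap /first_pos; lia.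
- move=> i j; rewrite !inE => lti ltj.
  rewrite -[i]/(val (Ordinal lti)) -[j]/(val (Ordinal ltj)) !FE => e.
  by congr val; apply: (inj _ _ _ _ (ng _) (ng _)); rewrite ?lt ?e.
- move=> i j lti ltj.
  rewrite -[i]/(val (Ordinal lti)) -[j]/(val (Ordinal ltj)) !FE => e.
  have ij : Ordinal ltj = Ordinal lti.
    by apply: (inj _ _ _ _ (ng _) (nf _)); rewrite ?lt ?e.
  by move: e; rewrite ij /gap; lia.
Qed.

(* Which of the two visits of a task comes first does not matter: if the
   "second" one comes earlier, exchanging them is harmless. Idle positions
   are dropped by [pmap]. *)
Lemma visits_two_visits D f g : visits (size D) (nth 0 D) f g -> two_visits D.
Proof.
set n := size D => -[h1 h2 h3 h4 h5].
pose own (v : nat) : option 'I_n := [pick i : 'I_n | (f i == v) || (g i == v)].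
have ownP v i : own v = Some i <-> (v = f i \/ v = g i).
  rewrite /own; case: pickP => [j hj|none]; last first.
    by split=> // -[] e; have := none i; rewrite e eqxx ?orbT.
  have ij : (v = f i \/ v = g i) -> j = i.
    move=> hi; apply: val_inj; have lj := ltn_ord j; have li := ltn_ord i.
    case/orP: hj => /eqP ej; case: hi => ei.
    - by apply: h3; rewrite ?inE // ej.
    - by case: (h5 j i lj li); rewrite ej.
    - by case: (h5 i j li lj); rewrite ej.
    - by apply: h4; rewrite ?inE // ej.
  by split=> [[<-]|/ij -> //]; case/orP: hj => /eqP; [left | right].
(* Any common bound on the positions would do. *)
pose L := \sum_(i < n) (f i + g i).
have L_ge (i : 'I_n) : f i + g i <= L by rewrite /L (bigD1 i) //= leq_addr.
pose s := pmap own (iota 1 L).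
have split_s (i : 'I_n) : exists w1 w2, [/\ 0 < w1, w1 < w2, w2 <= L,
   (w1 = f i /\ w2 = g i) \/ (w1 = g i /\ w2 = f i) &
   s = pmap own (iota 1 w1.-1) ++ i :: pmap own (iota w1.+1 (w2 - w1).-1) ++
       i :: pmap own (iota w2.+1 (L - w2))].
  have hf := h1 i (ltn_ord i); have hg := h2 i (ltn_ord i).
  have fg := h5 i i (ltn_ord i) (ltn_ord i); have hL := L_ge i.
  have [w1 [w2 [p1 p2 p3 p4]]] : exists w1 w2, [/\ 0 < w1, w1 < w2, w2 <= L &
     (w1 = f i /\ w2 = g i) \/ (w1 = g i /\ w2 = f i)].
    case: (ltngtP (f i) (g i)) => // lt; [exists (f i), (g i)|exists (g i), (f i)];
      split; lia.
  exists w1, w2; split=> //.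
  have o1 : own w1 = Some i by apply/ownP; case: p4 => -[-> _]; [left | right].
  have o2 : own w2 = Some i by apply/ownP; case: p4 => -[_ ->]; [right | left].
  have eL : L = w1.-1 + (1 + ((w2 - w1).-1 + (1 + (L - w2)))) by lia.
  rewrite /s {1}eL.
  rewrite !iotaD !pmap_cat /=.
  have -> : 1 + w1.-1 = w1 by lia.
  rewrite o1 /= addn1; have -> : w1.+1 + (w2 - w1).-1 = w2 by lia.
  by rewrite o2 /= addn1.
have notin (i : 'I_n) a b : f i \notin iota a b -> g i \notin iota a b -> i \notin pmap own (iota a b).
  move=> nf ng; rewrite mem_pmap; apply/mapP => -[v hv] /esym /ownP [] e.
    by rewrite -e hv in nf.
  by rewrite -e hv in ng.
have cnt (i : 'I_n) : count_mem i s = 2.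
  have [w1 [w2 [p1 p2 p3 p4 ->]]] := split_s i.
  rewrite !count_cat /= !count_cat /= eqxx.
  have z a b : f i \notin iota a b -> g i \notin iota a b -> count_mem i (pmap own (iota a b)) = 0.
    by move=> nf ng; apply/count_memPn; apply: notin.
  by rewrite !z // ?mem_iota; lia.
have size_pm a b : size (pmap own (iota a b)) <= b.
  by rewrite size_pmap; apply: leq_trans (count_size _ _) _; rewrite size_iota.
exists s; rewrite -/n; split=> [|i].
  have : size s = \sum_(i : 'I_n) count_mem i s.
    rewrite -sum1_size (partition_big id xpredT) //=; apply: eq_bigr => i _.
    by rewrite -sum1_count.
  by move=> ->; rewrite (eq_bigr (fun=> 2)) // sum_nat_const card_ord mulnC.
have hf := h1 i (ltn_ord i); have hg := h2 i (ltn_ord i).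
split=> //; rewrite /gap /first_pos; have [w1 [w2 [p1 p2 p3 p4 ->]]] := split_s i.
all: have n1 : i \notin pmap own (iota 1 w1.-1) by apply: notin; rewrite mem_iota; lia.
all: have n2 : i \notin pmap own (iota w1.+1 (w2 - w1).-1) by apply: notin; rewrite mem_iota; lia.
all: have s1 := size_pm 1 w1.-1; have s2 := size_pm w1.+1 (w2 - w1).-1.
all: rewrite index_cat (negbTE n1) /= eqxx addn0.
  (* The smaller of the two positions is at most [f i], whichever visit comes first; likewise the
     distance is below [f i] if the second visit comes first. *)
  by apply: leq_ltn_trans s1 _; lia.
rewrite -cat_rcons drop_size_cat ?size_rcons // index_cat (negbTE n2) /= eqxx addn0.
by apply: leq_ltn_trans s2 _; lia.
Qed.

(** * Independence of the clusters *)

Lemma mkseq_cat (T : Type) (f : nat -> T) a b :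
  mkseq f (a + b) = mkseq f a ++ mkseq (fun i => f (a + i)) b.
Proof.
rewrite /mkseq iotaD map_cat add0n; congr (_ ++ _).
by rewrite -[in LHS](addn0 a) iotaDl -map_comp.
Qed.

Lemma count_iota_cat (a : pred nat) r s :
  count a (iota 0 (r + s)) = count a (iota 0 r) + count (fun i => a (r + i)) (iota 0 s).
Proof.
rewrite iotaD count_cat add0n -[in X in _ + count _ X](addn0 r) iotaDl count_map.
by [].
Qed.

Section Blocks.
Variables (d : nat -> nat) (n : nat).
Hypotheses (n_gt0 : 0 < n) (d_gt0 : forall i, i < n -> 0 < d i)
  (d_mono : forall i j, i <= j < n -> d i <= d j).
Let al := alpha d n.
Let bend := block_end al n.
Let bstart := block_start al n.

Lemma block_startP j : [/\ bstart j <= j,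
  forall l, bstart j <= l < j -> ~~ bend l & (bstart j == 0) || bend (bstart j).-1].
Proof.
elim: j => [|j [h1 h2 h3]]; first by split=> // l; lia.
rewrite /bstart block_start_S -/(bend j); case e: (bend j).
  by split; [lia | move=> l; lia | rewrite /= -/(bend j) e].
rewrite -/(bstart j); split=> //; first by lia.
by move=> l hl; case: (ltngtP l j) => lj; [apply: h2; lia | lia | rewrite lj e].
Qed.

Lemma alpha_gap r s : r <= s < n -> al r + (s - r) <= al s.
Proof.
elim: s => [|s IH] rs; first by rewrite leqn0 in rs; case/andP: rs => /eqP -> _; rewrite addn0.
case: (r =P s.+1) => [->|ne]; first by rewrite subnn addn0.
by have := IH ltac:(lia); have := alpha_lt n_gt0 d_gt0 (r := s) ltac:(lia); rewrite -/al; lia.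
Qed.

Lemma block_end_next e l : bend e -> e < l < n -> al e + 1 < al l.
Proof.
rewrite /bend /block_end => be el.
have h1 := alpha_lt n_gt0 d_gt0 (r := e) ltac:(lia).
have h2 := alpha_gap (r := e.+1) (s := l) ltac:(lia).
by move: be h1; rewrite -/al; lia.
Qed.

(** The tight entry found by [alpha_tight] is reached in steps of 1, and no such step leaves the end
    of a block. *)
Lemma block_end_tight e : e < n -> bend e -> al e = d e + n.
Proof.
move=> en be; have [e' [h1 h2 h3]] := alpha_tight n_gt0 d_gt0 en.
case: (e' =P e) => [<- //|ne].
have h4 := block_end_next be (l := e.+1) ltac:(lia).
have h5 := alpha_gap (r := e.+1) (s := e') ltac:(lia).
by move: h3 h4 h5; rewrite -/al; lia.
Qed.

Lemma block_end_last : bend n.-1.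
Proof. by rewrite /bend /block_end prednK // eqxx. Qed.

Let F (x : nat -> nat) i := free_rank d n (al i - n + x i).

(** The ranks are shifted by the [i0] ranks left to earlier slots. Truncation is harmless: a
    threshold of at most [i0] becomes 0 and violates the condition for [k = 0]. *)
Definition locally_placeable (i0 m : nat) : Prop :=
  exists x : nat -> nat,
    [/\ perm_eq (mkseq x m) (mkseq (fun T => d (i0 + T)) m),
        forall U, U < m -> n < al (i0 + U) <= x U + n &
        forall k, count (fun U => free_rank d n (al (i0 + U) - n + x U) - i0 <= k) (iota 0 m) <= k].

(* Slots after [e] need deadlines larger than [d e], so that the deadlines up
   to [d e] fill the slots up to [e]. *)
Lemma prefix_perm x e : perm_eq (mkseq x n) (mkseq d n) ->
  (forall i, i < n -> al i <= x i + n) -> e < n -> bend e ->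
  perm_eq (mkseq x e.+1) (mkseq d e.+1).
Proof.
move=> pxd hx en be; have te := block_end_tight en be.
have en' : n = e.+1 + (n - e.+1) by lia.
have tail (y : nat -> nat) : (forall i, i < n -> al i <= y i + n) ->
   count (fun v => v <= d e) (mkseq (fun i => y (e.+1 + i)) (n - e.+1)) = 0.
  move=> hy; apply/eqP; rewrite -leqn0 leqNgt -has_count; apply/hasP => -[v /mapP [i]].
  rewrite mem_iota => hi -> le; have := hy (e.+1 + i) ltac:(lia).
  by have := block_end_next be (l := e.+1 + i) ltac:(lia); lia.
have hd i : i < n -> al i <= d i + n by move=> lt; apply: alpha_le.
have dall : all (fun v => v <= d e) (mkseq d e.+1).
  by apply/allP => v /mapP [i]; rewrite mem_iota => hi ->; apply: d_mono; lia.
have filt (y : nat -> nat) : (forall i, i < n -> al i <= y i + n) ->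
   all (fun v => v <= d e) (mkseq y e.+1) -> [seq v <- mkseq y n | v <= d e] = mkseq y e.+1.
  move=> hy /all_filterP ally; rewrite en' mkseq_cat filter_cat ally.
  have -> : [seq v <- mkseq (fun i => y (e.+1 + i)) (n - e.+1) | v <= d e] = [::].
    by apply: size0nil; rewrite size_filter tail.
  by rewrite cats0.
rewrite -(filt d) // -(filt x) //; first exact: perm_filter.
rewrite all_count size_mkseq -[X in X == _]addn0 -(tail x hx) -count_cat -mkseq_cat -en'.
rewrite (permP pxd) en' mkseq_cat count_cat tail // addn0.
by move: dall; rewrite all_count size_mkseq.
Qed.

Lemma placeable_local x j : perm_eq (mkseq x n) (mkseq d n) -> placeable d n x ->
  j < n -> bend j -> locally_placeable (bstart j) (j.+1 - bstart j).
Proof.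
move=> pxd [h1 h2] jn bj; have [s_le _ sb] := block_startP j.
set s := bstart j in s_le sb *; set m := j.+1 - s.
have hx i : i < n -> al i <= x i + n by move=> /h1 /andP [].
have jm : j.+1 = s + m by rewrite /m; lia.
have pre : perm_eq (mkseq x s) (mkseq d s).
  case/orP: sb => [/eqP -> //|bs]; case: (s) bs s_le => // s' bs s_le.
  by apply: prefix_perm => //; lia.
exists (fun U => x (s + U)); split.
- have := prefix_perm pxd hx jn bj; rewrite jm !mkseq_cat.
  by rewrite (permPl (perm_cat pre (perm_refl _))) perm_cat2l.
- by move=> U Um; apply: h1; lia.
- move=> k; set C := count _ _.
  (* If some slot [s + U] of the block has threshold at most s + k, then so have all [s] earlier
     slots; they use up [s] of the global bound s + k and leave [k] to the block. *)
  have [/hasP [U]|none] := boolP (has (fun U => F x (s + U) - s <= k) (iota 0 m)); last first.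
    have : C = 0; last by move->.
    by apply/eqP; rewrite -leqn0 leqNgt -has_count; apply: none.
  rewrite mem_iota => Um FU; have := h2 (s + k).
  have nn : n = s + (m + (n - (s + m))) by lia.
  rewrite [in iota 0 _]nn count_iota_cat count_iota_cat.
  have -> : count (fun i => free_rank d n (al i - n + x i) <= s + k) (iota 0 s) = s.
    apply/eqP; rewrite -[X in _ == X](size_iota 0 s) -all_count; apply/allP => i.
    rewrite mem_iota => is_; apply: (@leq_trans (F x (s + U))); last by lia.
    apply: free_rank_mono => //.
    have [s' es] : exists s', s = s'.+1 by exists s.-1; lia.
    have bs' : bend s' by move: sb; rewrite es.
    (* An earlier slot has a smaller value and also a smaller deadline: [x i <= d s'], while d s' +
       n = al s' lies below al (s + U), which is at most x (s + U) + n. *)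
    have te := block_end_tight (e := s') ltac:(lia) bs'.
    have h3 := alpha_gap (r := i) (s := s') ltac:(lia).
    have h4 := block_end_next bs' (l := s + U) ltac:(lia).
    have h5 := hx (s + U) ltac:(lia).
    have : x i <= d s'.
      have : x i \in mkseq d s by rewrite -(perm_mem pre); apply: map_f; rewrite mem_iota.
      by case/mapP => t; rewrite mem_iota => ht ->; apply: d_mono; lia.
    by lia.
  have : C <= count (fun i => free_rank d n (al (s + i) - n + x (s + i)) <= s + k) (iota 0 m).
    by apply: sub_count => U' /=; lia.
  by move=> le; rewrite leq_add2l => le'; apply: leq_trans le (leq_trans (leq_addr _ _) le').
Qed.

Lemma local_placeable :
  (forall j, j < n -> bend j -> locally_placeable (bstart j) (j.+1 - bstart j)) ->
  exists2 x, perm_eq (mkseq x n) (mkseq d n) & placeable d n x.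
Proof.
move=> loc.
pose good r x := [/\ perm_eq (mkseq x r) (mkseq d r),
   forall i, i < r -> n < al i <= x i + n & forall k, count (fun i => F x i <= k) (iota 0 r) <= k].
suff H j : j < n -> bend j -> exists x, good j.+1 x.
  have [x] := H n.-1 ltac:(lia) block_end_last; rewrite prednK // => -[h1 h2 h3].
  by exists x.
elim/ltn_ind: j => j IH jn bj; have [s_le _ sb] := block_startP j.
have [y] := loc j jn bj; set s := bstart j in s_le sb *; set m := j.+1 - s => -[y1 y2 y3].
have jm : j.+1 = s + m by rewrite /m; lia.
have [x [x1 x2 x3]] : exists x, good s x.
  case/orP: sb => [/eqP ->|bs]; first by exists d; split=> [||k] //.
  by case: (s) bs s_le => [_ _|s' bs s_le]; [exists d; split=> [||k] | apply: IH => //; lia].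
pose z i := if i < s then x i else y (i - s).
have zl i : i < s -> z i = x i by rewrite /z => ->.
have zr i : z (s + i) = y i by rewrite /z ltnNge leq_addr addKn.
have F1 i : i < s -> F z i = F x i by move=> lt; rewrite /F zl.
exists z; rewrite jm; split.
- rewrite !mkseq_cat perm_cat //.
    rewrite (_ : mkseq z s = mkseq x s) //; apply/eq_in_map => i.
    by rewrite mem_iota => lt; apply: zl.
  by rewrite (eq_mkseq zr).
- move=> i lt; case: (ltnP i s) => is_; first by rewrite zl ?x2.
  have -> : i = s + (i - s) by lia.
  by rewrite zr; apply: y2; lia.
- move=> k; rewrite count_iota_cat.
  rewrite (@eq_in_count _ _ (fun i => F x i <= k)) => [|i]; last first.
    by rewrite mem_iota => lt; rewrite F1.
  have c1 := x3 k; have c2 := count_size (fun i => F x i <= k) (iota 0 s).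
  rewrite size_iota in c2.
  have c3 : count (fun i => F z (s + i) <= k) (iota 0 m) <= k - s.
    apply: leq_trans (y3 (k - s)); apply: sub_count => i /=.
    by rewrite /F zr; lia.
  (* The earlier slots contribute at most the minimum of [s] and [k], and the block at most k -
     s. *)
  apply: leq_trans (_ : count (fun i => F x i <= k) (iota 0 s) + (k - s) <= k); last by lia.
  exact: leq_add.
Qed.

End Blocks.

(** * Clusters of the discretized sequence as blocks *)

Section Clusters.
Variable D : seq nat.
Hypothesis D_inst : is_instance D.
Let n := size D.
Let S := sorted_deadlines D.
Let d := nth 0 S.
Let al := alpha d n.

Lemma size_sorted_deadlines : size S = n.
Proof. by rewrite size_sort. Qed.

Lemma inst_n_gt0 : 0 < n. Proof. by case/andP: D_inst. Qed.

Lemma inst_d_gt0 i : i < n -> 0 < d i.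
Proof.
move=> lt; case/andP: D_inst => _ /allP h; apply: h.
by rewrite -(mem_sort leq); apply: mem_nth; rewrite size_sorted_deadlines.
Qed.

Lemma inst_d_mono i j : i <= j < n -> d i <= d j.
Proof.
case/andP=> ij jn; apply: (sorted_leq_nth leq_trans leqnn 0 (sort_sorted leq_total D)) => //;
  rewrite inE size_sorted_deadlines //; exact: leq_ltn_trans jn.
Qed.

(** Stated for suffixes because both recursions start from the last entry. *)
Lemma discretize_drop k : k <= n ->
  discretize (drop (n - k) S) = [seq (Posz (al i) - Posz n)%R | i <- iota (n - k) k].
Proof.
elim: k => [|k IH] kn.
  by rewrite subn0 drop_oversize // size_sorted_deadlines.
rewrite (drop_nth 0) ?size_sorted_deadlines; last by lia.
have -> : (n - k.+1).+1 = n - k by lia.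
rewrite /= IH; last by lia.
have st : al (n - k.+1) = minn (al (n - k.+1).+1).-1 (d (n - k.+1) + n).
  by apply: alpha_step; try lia; exact: inst_d_gt0.
have := alpha_gt inst_n_gt0 inst_d_gt0 (r := (n - k.+1).+1) ltac:(lia).
move: st; have -> : (n - k.+1).+1 = n - k by lia.
rewrite -/al -/d; case: k IH kn => [|k] IH kn /= st.
  rewrite subn0 in st *; have := alpha_top d n; rewrite -/al => top.
  have e : n.-1 = n - 1 by lia.
  by move=> _; rewrite st top e; congr [:: _]; lia.
move=> gt; rewrite st; congr (_ :: _); rewrite /Order.min.
by case: ifP => lt; lia.
Qed.
End Clusters.

(** Both enumerations of the clusters increase in this lexicographic order, so they agree as lists;
    the output word depends on the order. *)
Definition pair_lt (C C' : nat * nat) : bool :=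
  (C.1 < C'.1) || (C.1 == C'.1) && (C.2 < C'.2).

Lemma pair_lt_trans : transitive pair_lt.
Proof. by move=> [a b] [c e] [f g]; rewrite /pair_lt /=; lia. Qed.

Lemma pair_lt_irr : irreflexive pair_lt.
Proof. by move=> [a b]; rewrite /pair_lt /=; lia. Qed.

Lemma index_pairs_sorted n : sorted pair_lt (index_pairs n).
Proof.
rewrite (sorted_pairwise pair_lt_trans) /index_pairs.
have iota_lt a b : pairwise ltn (iota a b).
  by rewrite -(sorted_pairwise ltn_trans) iota_ltn_sorted.
have := iota_lt 0 n; elim: {1 3}(iota 0 n) => //= i s IH /andP [/allP hi hs].
rewrite pairwise_cat IH // andbT; apply/andP; split.
  apply/allrelP => -[a b] [a' b'] /mapP [j _ [-> ->]] /allpairsP [[i' j'] [/= h1 _ [-> ->]]].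
  by rewrite /pair_lt /=; have /= -> := hi _ h1.
rewrite pairwise_map; apply: sub_pairwise (iota_lt 0 n) => a b ab.
by move: ab; rewrite /pair_lt /= eqxx => ->; rewrite orbT.
Qed.

Section ClusterList.
Variable D : seq nat.
Hypothesis D_inst : is_instance D.
Let n := size D.
Let d := nth 0 (sorted_deadlines D).
Let al := alpha d n.
Let n_gt0 : 0 < n := inst_n_gt0 D_inst.

Lemma size_discretized : size (discretized D) = n.
Proof.
have := discretize_drop D_inst (leqnn n); rewrite subnn drop0 => e.
by rewrite /discretized e size_map size_iota.
Qed.

Lemma nth_discretized i : i < n -> nth 0%R (discretized D) i = (Posz (al i) - Posz n)%R.
Proof.
move=> lt; have := discretize_drop D_inst (leqnn n); rewrite subnn drop0 => e.
by rewrite /discretized e (nth_map 0) ?size_iota // nth_iota.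
Qed.

Lemma consecutiveP i j : reflect (i <= j < n /\ forall l, i <= l < j -> ~~ block_end al n l)
  (consecutive (discretized D) (i, j)).
Proof.
have key l : l.+1 < n -> (nth 0 (discretized D) l.+1 == nth 0 (discretized D) l + 1)%R
    = ~~ block_end al n l.
  move=> lt; rewrite !nth_discretized //; last by lia.
  by rewrite /block_end; lia.
rewrite /consecutive /= size_discretized; apply: (iffP and3P) => [[h1 h2 /allP h3]|[h1 h2]].
  split=> [|l hl]; first by rewrite h1.
  by rewrite -key; [apply: h3; rewrite mem_iota; lia | lia].
split; [lia | lia | apply/allP => l; rewrite mem_iota => hl].
by rewrite key; [apply: h2; lia | lia].
Qed.

Lemma is_clusterP i j :
  is_cluster (discretized D) (i, j) = [&& j < n, block_end al n j & i == block_start al n j].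
Proof.
have [s_le s_in s_out] := block_startP d n_gt0 j; rewrite -/al in s_le s_in s_out.
rewrite /is_cluster size_discretized; apply/andP/and3P => [[/consecutiveP [ij nb] /allP mx]|].
  have max i' j' : consecutive (discretized D) (i', j') -> i' <= i -> j <= j' -> i' = i /\ j' = j.
    move=> c h1 h2; have [h3 _] := elimT (consecutiveP _ _) c.
    have : (i', j') \in index_pairs n by apply/allpairsP; exists (i', j'); rewrite !mem_iota /=; split=> //; lia.
    by move=> /mx /implyP /=; rewrite c h1 h2 => /(_ isT) /eqP [-> ->].
  split; first by lia.
    apply: contraT => nbj; suff cj : consecutive (discretized D) (i, j.+1).
      by have [_] := max _ _ cj (leqnn i) (leqnSn j); lia.
    apply/consecutiveP; split; first by move: nbj; rewrite /block_end; lia.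
    by move=> l hl; case: (l =P j) => [->//|ne]; apply: nb; lia.
  case: (ltngtP i (block_start al n j)) => // lt.
    move: s_out; case: (block_start al n j) lt s_le => // s lt s_le /= bs.
    by have := nb s ltac:(lia); rewrite bs.
  suff cj : consecutive (discretized D) (block_start al n j, j).
    by have [e _] := max _ _ cj (ltnW lt) (leqnn j); lia.
  by apply/consecutiveP; split=> //; lia.
case=> jn bj /eqP ->; split; first by apply/consecutiveP; split=> //; lia.
apply/allP => -[i' j'] _; apply/implyP => /and3P [/consecutiveP [ij' nb] /= h1 h2].
have jj : j' = j.
  by case: (ltngtP j' j) => // lt; [lia | have := nb j ltac:(lia); rewrite bj].
rewrite jj; case: (ltngtP i' (block_start al n j)) => [lt|lt|-> //]; last by lia.
move: s_out; case: (block_start al n j) lt s_le => // s lt s_le /= bs.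
by have := nb s ltac:(lia); rewrite bs.
Qed.

Lemma clustersE : clusters D =
  [seq (block_start al n j, j) | j <- iota 0 n & block_end al n j].
Proof.
apply: (irr_sorted_eq pair_lt_trans pair_lt_irr).
- by apply: sorted_filter (index_pairs_sorted n); apply: pair_lt_trans.
- rewrite (sorted_pairwise pair_lt_trans).
  suff H k : pairwise pair_lt [seq (block_start al n j, j) | j <- iota 0 k & block_end al n j] by exact: H.
  elim: k => // k IH; rewrite iota0S filter_rcons; case: ifP => // bk.
  rewrite map_rcons pairwise_rcons IH andbT; apply/allP => C /mapP [j].
  rewrite mem_filter mem_iota => /andP [bj jk] ->; rewrite /pair_lt /=.
  have [h1 _ _] := block_startP d n_gt0 j; have [h2 h3 _] := block_startP d n_gt0 k.
  rewrite -/al in h1 h2 h3; have : j < block_start al n k; last by lia.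
  by rewrite ltnNge; apply/negP => le; have := h3 j ltac:(lia); rewrite bj.
- move=> [i j]; rewrite mem_filter is_clusterP; apply/andP/mapP => [[/and3P [h1 h2 /eqP ->] _]|[j']].
    by exists j; rewrite // mem_filter h2 mem_iota.
  rewrite mem_filter mem_iota => /andP [bj jn] [-> ->]; rewrite bj eqxx andbT; split; first by lia.
  have [h1 _ _] := block_startP d n_gt0 j'; rewrite -/al in h1.
  by apply/allpairsP; exists (block_start al n j', j'); rewrite !mem_iota /=; split=> //; lia.
Qed.

Lemma cluster_deadlinesE i j : i <= j < n ->
  cluster_deadlines D (i, j) = mkseq (fun T => d (i + T)) (j.+1 - i).
Proof.
move=> ij; have sz : size (sorted_deadlines D) = n by rewrite size_sort.
have st : size (take j.+1 (sorted_deadlines D)) = j.+1 by rewrite size_takel ?sz; lia.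
apply: (@eq_from_nth _ 0); rewrite /cluster_deadlines /= size_drop st.
  by rewrite size_mkseq.
by move=> k hk; rewrite nth_drop nth_take ?nth_mkseq //; lia.
Qed.

End ClusterList.

(** * The instance of a cluster *)

Lemma digits_uniq B p (c c' : nat -> nat) :
  (forall q, q < p -> c q < B) -> (forall q, q < p -> c' q < B) ->
  \sum_(q < p) c q * B ^ q = \sum_(q < p) c' q * B ^ q ->
  forall q, q < p -> c q = c' q.
Proof.
have bound f k : (forall q, q < k -> f q < B) -> \sum_(q < k) f q * B ^ q < B ^ k.
  elim: k => [|k IH] hf; first by rewrite big_ord0.
  rewrite big_ord_recr /= expnS; have := IH (fun q hq => hf q (ltnW hq)).
  have := hf k (leqnn _); set s := \sum_(_ < _) _; set b := B ^ k; nia.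
elim: p => // p IH hc hc'; rewrite !big_ord_recr /= => e.
have hb := bound c p (fun q hq => hc q (ltnW hq)).
have hb' := bound c' p (fun q hq => hc' q (ltnW hq)).
have B0 : 0 < B ^ p by apply: leq_ltn_trans hb.
(* The lower digits sum to less than [B ^ p], so division isolates the top digit. *)
have top : c p = c' p.
  have := congr1 (fun x => x %/ B ^ p) e.
  by rewrite !(addnC (\sum_(_ < _) _)) !divnMDl // !divn_small // !addn0.
move=> q; rewrite ltnS leq_eqVlt => /orP [/eqP -> //|qp].
apply: IH qp => [r hr|r hr|]; [exact: hc (ltnW hr) | exact: hc' (ltnW hr) |].
by move: e; rewrite top => /addIn.
Qed.

(** With at most n entries, every multiplicity is a digit in base n + 1. *)
Lemma sum_pow_perm n (s t : seq nat) : size s <= n -> size t <= n ->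
  \sum_(a <- s) n.+1 ^ a = \sum_(a <- t) n.+1 ^ a -> perm_eq s t.
Proof.
move=> sn tn e; pose p := (\sum_(a <- s ++ t) a).+1.
have hp a : a \in s ++ t -> a < p by move=> h; rewrite /p (big_rem a h) /= ltnS leq_addr.
have expand (r : seq nat) : {subset r <= s ++ t} ->
    \sum_(a <- r) n.+1 ^ a = \sum_(q < p) count_mem (val q) r * n.+1 ^ q.
  elim: r => [|a r IH] sub; first by rewrite big_nil big1.
  rewrite big_cons IH => [|b br]; last by apply: sub; rewrite inE br orbT.
  have ap : a < p by apply/hp/sub; rewrite inE eqxx.
  rewrite (bigD1 (Ordinal ap)) // [in RHS](bigD1 (Ordinal ap)) //= eqxx mulnDl mul1n addnA.
  congr (_ + _); apply: eq_bigr => q ne.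
  have -> : (a == q) = false by apply: contraNF ne => /eqP h; apply/eqP/val_inj.
  by [].
have := @digits_uniq n.+1 p (fun q => count_mem q s) (fun q => count_mem q t).
rewrite -!expand; last 2 first.
- by move=> a h; rewrite mem_cat h orbT.
- by move=> a h; rewrite mem_cat h.
move=> H; apply/allP => a ha; apply/eqP; apply: H => //; last exact: hp.
- by move=> q _; rewrite ltnS; apply: leq_trans (count_size _ _) sn.
- by move=> q _; rewrite ltnS; apply: leq_trans (count_size _ _) tn.
Qed.

Section LocalMatching.
Variables (d : nat -> nat) (n i0 m : nat).
Hypotheses (n_gt0 : 0 < n) (m_gt0 : 0 < m) (block_bound : i0 + m <= n)
  (d_mono : forall i j, i <= j < n -> d i <= d j).
Let al := alpha d n.
Let cend := class_end d i0 m.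
Let rank := class_rank d i0 m.
Let wt := weight n d i0 m.
Let gs := gadgets n al d i0 m m.

Lemma class_rank_S T : rank T.+1 = rank T + cend T.
Proof. by rewrite /rank /class_rank iota0S -cats1 count_cat /= addn0. Qed.

Lemma class_rank_mono T T' : T <= T' -> rank T <= rank T'.
Proof.
elim: T' => [|T' IH]; first by rewrite leqn0 => /eqP ->.
rewrite leq_eqVlt => /orP [/eqP -> //|]; rewrite ltnS => /IH le.
by rewrite class_rank_S; lia.
Qed.

(** In sorted order equal deadlines are adjacent, so the rank grows exactly where the deadline
    does. *)
Lemma class_rank_eq T T' : T <= T' < m -> (rank T == rank T') = (d (i0 + T) == d (i0 + T')).
Proof.
elim: T' => [|T' IH] TT; first by have T0 : T = 0; [lia | rewrite T0 !eqxx].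
case: (T =P T'.+1) => [->|ne]; first by rewrite !eqxx.
have {}IH := IH ltac:(lia).
have h1 : rank T <= rank T' by apply: class_rank_mono; lia.
have h2 : d (i0 + T) <= d (i0 + T') by apply: d_mono; lia.
have h3 : d (i0 + T') <= d (i0 + T'.+1) by apply: d_mono; lia.
have h4 : cend T' = (d (i0 + T'.+1) != d (i0 + T')).
  by rewrite /cend /class_end addnS; case: eqP => //; lia.
have := class_rank_S T'; lia.
Qed.

Lemma class_rankP T T' : T < m -> T' < m -> (rank T == rank T') = (d (i0 + T) == d (i0 + T')).
Proof.
move=> Tm Tm'; case: (leqP T T') => le; first by rewrite class_rank_eq // le.
by rewrite eq_sym class_rank_eq 1?eq_sym //; lia.
Qed.

Lemma class_end_exists T : T < m -> exists T', [/\ T <= T' < m, cend T' & d (i0 + T') = d (i0 + T)].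
Proof.
move=> Tm; have [k hk] : exists k, m - T = k.+1 by exists (m - T).-1; lia.
elim: k T Tm hk => [|k IH] T Tm hk.
  exists T; split=> //; first by lia.
  by rewrite /cend /class_end (_ : T.+1 = m) ?eqxx //; lia.
case e: (cend T); first by exists T; split=> //; lia.
have [T' [h1 h2 h3]] := IH T.+1 ltac:(lia) ltac:(lia).
exists T'; split=> //; first by lia.
by move: e; rewrite h3 /cend /class_end addnS; lia.
Qed.

Lemma class_rank_lt T : T < m -> rank T < rank m.
Proof.
move=> Tm; have [T' [h1 h2 _]] := class_end_exists Tm.
have := class_rank_mono (T := T) (T' := T') ltac:(lia).
have := class_rank_mono (T := T'.+1) (T' := m) ltac:(lia).
by rewrite class_rank_S h2; lia.
Qed.

(** Ends of different classes carry different deadlines; this is how the parameter p bounds the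
    number of gadgets per slot. *)
Lemma class_rank_undup : rank m <= size (undup (mkseq (fun T => d (i0 + T)) m)).
Proof.
rewrite /rank /class_rank -size_filter -/cend -(size_map (fun T => d (i0 + T))).
apply: uniq_leq_size => [|v /mapP [T]]; last first.
  rewrite mem_filter => /andP [_ hT] ->; rewrite mem_undup; exact: map_f.
rewrite map_inj_in_uniq ?filter_uniq ?iota_uniq // => T T'.
rewrite !mem_filter !mem_iota => /andP [e Tm] /andP [e' Tm'] /eqP.
rewrite -class_rankP; try lia; move=> /eqP eqr.
case: (ltngtP T T') => // lt.
  have := class_rank_mono lt; rewrite class_rank_S e; lia.
have := class_rank_mono lt; rewrite class_rank_S e'; lia.
Qed.

Lemma mem_gadgets g :
  reflect (exists T U, [/\ T < m, cend T, U < m & g = (U, wt T, width n al d i0 m T U)]) (g \in gs).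
Proof.
apply: (iffP flatten_mapP) => [[T]|[T [U [Tm eT Um ->]]]].
  rewrite mem_filter mem_iota => /andP [eT Tm] /mapP [U]; rewrite mem_iota => Um ->.
  by exists T, U.
exists T; first by rewrite mem_filter mem_iota; apply/andP.
by apply/mapP; exists U; rewrite ?mem_iota.
Qed.

Lemma gadgets_uniq : uniq gs.
Proof.
rewrite /gs /gadgets /class_gadgets.
rewrite (allpairs_uniq_dep (f := fun T U => (U, wt T, width n al d i0 m T U))) //.
- by rewrite filter_uniq ?iota_uniq.
- by move=> T _; apply: iota_uniq.
- move=> [T U] [T' U'] /allpairsPdep [a [b [+ _ [e1 e2]]]] /allpairsPdep [a' [b' [+ _ [e1' e2']]]].
  rewrite e1 e1' !mem_filter !mem_iota => /andP [eT Tm] /andP [eT' Tm'] /= [-> + _].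
  rewrite /wt /weight => /eqP; rewrite eqn_exp2l // => /eqP eqr.
  suff -> : a = a' by [].
  have ea : cend a := eT; have ea' : cend a' := eT'; have er : rank a = rank a' := eqr.
  case: (ltngtP a a') => // lt; have := class_rank_mono lt; rewrite class_rank_S ?ea ?ea' er; lia.
Qed.

Lemma gadgets_ok g : g \in gs -> [/\ g.1.1 < m, 0 < g.1.2 & g.2 <= m].
Proof.
move=> /mem_gadgets [T [U [Tm eT Um ->]]]; split=> //=; first by rewrite /wt /weight expn_gt0.
by rewrite /width; case: ifP => // _; apply: geq_minl.
Qed.

Lemma red_target_gt0 : 0 < red_target n d i0 m m.
Proof.
by rewrite /red_target; case: (m) m_gt0 => // k _; rewrite red_target_S addn_gt0 /weight expn_gt0 orbT.
Qed.

Lemma red_targetE : red_target n d i0 m m = \sum_(T <- iota 0 m) wt T.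
Proof. by rewrite /red_target sumnE big_map. Qed.

Lemma sum_ord_iota (f : nat -> nat) : \sum_(i < m) f i = \sum_(i <- iota 0 m) f i.
Proof. by rewrite -(big_mkord xpredT f) /index_iota subn0. Qed.

Lemma widthE T U : n < al (i0 + U) ->
  al (i0 + U) + d (i0 + T) - (rank_count n al (al (i0 + U) + d (i0 + T)) + n + i0) =
  free_rank d n (al (i0 + U) - n + d (i0 + T)) - i0.
Proof.
move=> h; rewrite /free_rank -/al.
have -> : al (i0 + U) - n + d (i0 + T) + n = al (i0 + U) + d (i0 + T) by lia.
lia.
Qed.

Definition local_instance : em_instance :=
  list_instance (m + m + inner_vertices gs) (edges m (m + m) gs) (red_target n d i0 m m).

Lemma matching_local : exact_matching local_instance -> locally_placeable d n i0 m.
Proof.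
move=> em; have [G [J [GP Jinj sumk]]] := matching_choice gadgets_ok m_gt0 red_target_gt0 em.
pose ok (U T : 'I_m) := G U = (val U, wt T, width n al d i0 m T U).
have ex (U : 'I_m) : exists T, ok U T.
  have [/mem_gadgets [T [U' [Tm _ _ e]]] eU _] := GP U.
  by exists (Ordinal Tm); rewrite /ok e /= -eU e.
have [tau tauP] := @fin_all_exists _ (fun=> 'I_m) ok ex.
pose t U := if insub U is Some o then val (tau o) else 0.
have tE (U : 'I_m) : t U = tau U by rewrite /t valK.
have tlt U : U < m -> t U < m by move=> Um; rewrite -[U]/(val (Ordinal Um)) tE.
pose x U := d (i0 + t U).
have hw U (Um : U < m) : J (Ordinal Um) < width n al d i0 m (t U) U.
  by have [_ _] := GP (Ordinal Um); rewrite tauP -tE.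
exists x; split.
- pose dv q := d (i0 + find (fun T => rank T == q) (iota 0 m)).
  have dvP T : T < m -> dv (rank T) = d (i0 + T).
    move=> Tm; have hs : has (fun T' => rank T' == rank T) (iota 0 m).
      by apply/hasP; exists T; rewrite ?mem_iota.
    have lt : find (fun T' => rank T' == rank T) (iota 0 m) < m.
      by rewrite -[X in _ < X](size_iota 0) -has_find.
    have := nth_find 0 hs; rewrite nth_iota // add0n class_rankP //.
    by move/eqP.
  (* Here the exact number of red edges is used: it forces the classes given to the slots to be
     those of the cluster with their multiplicities. *)
  have pr : perm_eq (mkseq (fun U => rank (t U)) m) (mkseq rank m).
    apply: (@sum_pow_perm n); rewrite ?size_mkseq; try lia.
    rewrite !big_map -sum_ord_iota -[RHS]red_targetE -sumk.
    by apply: eq_bigr => U _; rewrite tE tauP.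
  have := perm_map dv pr; rewrite -!map_comp.
  rewrite (@eq_in_map _ _ (dv \o (fun U => rank (t U))) x (iota 0 m)).1 => [|U]; last first.
    by rewrite mem_iota => Um; rewrite /= dvP ?tlt.
  rewrite (@eq_in_map _ _ (dv \o rank) (fun T => d (i0 + T)) (iota 0 m)).1 => [//|U].
  by rewrite mem_iota => Um; rewrite /= dvP.
- move=> U Um; have := hw U Um; rewrite /width.
  by case: ifP => // /andP [-> ->].
(* Slots with threshold at most [k] are matched to distinct ranks below [k]. *)
- move=> k; rewrite -size_filter.
  pose jn U := if insub U is Some o then val (J o) else 0.
  have jE U (Um : U < m) : jn U = J (Ordinal Um) by rewrite /jn insubT.
  rewrite -(size_map jn); apply: uniq_bounded_size => [|y /mapP [U]].
    rewrite map_inj_in_uniq ?filter_uniq ?iota_uniq // => U U'.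
    rewrite !mem_filter !mem_iota => /andP [_ Um] /andP [_ Um'].
    by rewrite !jE => /val_inj/Jinj [].
  rewrite mem_filter mem_iota => /andP [le Um] ->; rewrite (jE _ Um).
  apply: leq_trans le; have := hw U Um; rewrite /width.
  case: ifP => // /andP [h1 h2]; rewrite widthE // leq_min => /andP [_].
  by [].
Qed.

Lemma local_matching : locally_placeable d n i0 m -> exact_matching local_instance.
Proof.
case=> x [pxd x1 x2]; have [rho rho_inj rhoP] := hall_threshold x2.
(* Only class ends have gadgets, so [T] is the representative of the class of the deadline given to
   [U]. *)
pose ok (U T : 'I_m) := cend T /\ d (i0 + T) = x U.
have ex (U : 'I_m) : exists T, ok U T.
  have : x U \in mkseq x m by apply: map_f; rewrite mem_iota ltn_ord.
  rewrite (perm_mem pxd) => /mapP [T]; rewrite mem_iota => Tm e.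
  have [T' [h1 h2 h3]] := class_end_exists (T := T) Tm.
  have Tm' : T' < m by lia.
  by exists (Ordinal Tm'); split=> //=; rewrite h3 e.
have [tau tauP] := @fin_all_exists _ (fun=> 'I_m) ok ex.
have rm (U : 'I_m) : rho U < m by have [] := rhoP U (ltn_ord U).
apply: (@choice_matching m gs gadgets_ok _
  (fun U => (val U, wt (tau U), width n al d i0 m (tau U) U)) (fun U => Ordinal (rm U))) => //.
- exact: red_target_gt0.
- exact: gadgets_uniq.
- move=> U; have [c e] := tauP U; split=> //=.
    by apply/mem_gadgets; exists (tau U), U; split.
  have [_ r] := rhoP U (ltn_ord U); have h := x1 U (ltn_ord U).
  rewrite /width widthE; last by case/andP: h.
  by rewrite e h leq_min rm.
- by move=> U U' [] e; apply: val_inj; apply: rho_inj => //; rewrite inE ltn_ord.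
- rewrite red_targetE /=.
  pose W v := wt (find (fun T => d (i0 + T) == v) (iota 0 m)).
  have WP T : T < m -> W (d (i0 + T)) = wt T.
    move=> Tm; have hs : has (fun T' => d (i0 + T') == d (i0 + T)) (iota 0 m).
      by apply/hasP; exists T; rewrite ?mem_iota.
    have lt : find (fun T' => d (i0 + T') == d (i0 + T)) (iota 0 m) < m.
      by rewrite -[X in _ < X](size_iota 0) -has_find.
    have := nth_find 0 hs; rewrite nth_iota // add0n -class_rankP //.
    by move/eqP; rewrite /W /wt /weight -/rank => ->.
  rewrite (eq_bigr (fun U : 'I_m => W (x U))) => [|U _]; last first.
    by have [_ <-] := tauP U; rewrite WP.
  rewrite (sum_ord_iota (fun U => W (x U))) -(big_map x xpredT W) (perm_big _ pxd) big_map.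
  by apply: eq_big_seq => T; rewrite mem_iota => Tm; apply: WP.
Qed.

End LocalMatching.

(** * Bounds on size and time *)

Lemma expnS_bound n k : k <= n -> n.+1 ^ k * (n.+1 - k) <= n.+1 * n ^ k.
Proof.
elim: k => [|k IH] kn; first by rewrite !expn0; lia.
have h := IH (ltnW kn); rewrite !expnS.
have e : n.+1 * (n - k) <= n * (n.+1 - k) by nia.
rewrite subSS; move: (n.+1 ^ k) (n ^ k) h => a b h.
have h1 : a * (n.+1 * (n - k)) <= a * (n * (n.+1 - k)) by rewrite leq_mul2l e orbT.
have h2 : n * (a * (n.+1 - k)) <= n * (n.+1 * b) by rewrite leq_mul2l h orbT.
by lia.
Qed.

(** Replaces base n + 1 by n at the cost of a factor 2. [expnS_bound] is Bernoulli's inequality for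
    (1 - 1/(n + 1))^k without denominators; the remaining factor n + 1 fits because the exponent is
    only p - 1. *)
Lemma weight_bound n p : 0 < p <= n -> n.+1 ^ p.-1 <= 2 * n ^ p.
Proof.
case: p => // k kn /=; have h := @expnS_bound n k ltac:(lia).
have : n.+1 ^ k <= n.+1 ^ k * (n.+1 - k) by rewrite leq_pmulr //; lia.
have : n.+1 * n ^ k <= 2 * n ^ k.+1 by rewrite expnS mulnA leq_mul2r; lia.
lia.
Qed.

Lemma leq_expn_self n p : 0 < p -> n <= n ^ p.
Proof. by case: n p => // n [] // p _; rewrite expnS leq_pmulr // expn_gt0. Qed.

Section Bounds.
Variables (d : nat -> nat) (n i0 m p : nat).
Hypotheses (m_gt0 : 0 < m) (block_bound : i0 + m <= n) (p_bound : 0 < p <= n)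
  (d_mono : forall i j, i <= j < n -> d i <= d j)
  (rank_p : class_rank d i0 m m <= p).
Let al := alpha d n.
Let gs := gadgets n al d i0 m m.

Lemma block_weight T : T < m -> weight n d i0 m T <= 2 * n ^ p.
Proof.
move=> Tm; have lt : class_rank d i0 m T < class_rank d i0 m m by apply: (@class_rank_lt d n i0 m) => //; lia.
apply: leq_trans (weight_bound p_bound); rewrite /weight leq_exp2l; lia.
Qed.

Lemma class_gadgets_bound k c (f : nat -> nat) :
  k <= m -> (forall T, T < m -> class_end d i0 m T -> f T <= c) ->
  \sum_(T < k) (if class_end d i0 m T then f T else 0) <= class_rank d i0 m k * c.
Proof.
move=> km hf; elim: k km => [|k IH] km; first by rewrite big_ord0.
have := IH (ltnW km); rewrite big_ord_recr /= /class_rank iota0S -cats1 count_cat /= addn0 mulnDl.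
by case e: (class_end d i0 m k) => /= h; rewrite ?mul1n; apply: leq_add => //; apply: hf.
Qed.

Lemma inner_vertices_gadgets k : inner_vertices (gadgets n al d i0 m k) =
  \sum_(T < k) (if class_end d i0 m T then 2 * (m * weight n d i0 m T) else 0).
Proof.
elim: k => [|k IH]; first by rewrite big_ord0.
rewrite gadgets_S inner_vertices_cat IH big_ord_recr /=; congr (_ + _).
case: ifP => // _; rewrite /inner_vertices /class_gadgets -map_comp; congr (2 * _).
by rewrite sumnE big_map /= big_const_seq count_predT size_iota iter_addn_0 mulnC.
Qed.

Lemma size_links u z w : size (links u z w) = 2 * w.
Proof. by elim: w => // w IH; rewrite links_S !size_rcons IH; lia. Qed.

Lemma size_edges z hs : size (edges m z hs) = inner_vertices hs + sumn [seq g.2 | g <- hs].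
Proof.
elim: hs z => // [[[u w] h]] hs IH z; rewrite /= size_cat IH -cat1s inner_vertices_cat inner_vertices1.
by rewrite /chain size_cat size_links /finals size_map size_iota /=; lia.
Qed.

Lemma sum_widths k : k <= m ->
  sumn [seq g.2 | g <- gadgets n al d i0 m k] <= class_rank d i0 m k * (m * m).
Proof.
elim: k => // k IH km; rewrite gadgets_S map_cat sumn_cat.
rewrite /class_rank iota0S -cats1 count_cat /= addn0 mulnDl; apply: leq_add; first exact: IH (ltnW km).
case: ifP => // _; rewrite mul1n sumnE big_map big_map.
rewrite -[X in _ <= X * _](size_iota 0 m) -sum1_size big_distrl /=; apply: leq_sum => U _.
by rewrite mul1n /width; case: ifP => // _; apply: geq_minl.
Qed.

(** The 4 arises from 2 inner vertices per unit of weight and the factor 2 of [weight_bound]. *)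
Lemma inner_bound : inner_vertices gs <= 4 * (m * (n ^ p * p)).
Proof.
rewrite inner_vertices_gadgets.
have := @class_gadgets_bound m (4 * (m * n ^ p)) (fun T => 2 * (m * weight n d i0 m T)) (leqnn m).
have h := leq_mul rank_p (leqnn (4 * (m * n ^ p))).
move=> H; apply: leq_trans (H _) _; last by lia.
move=> T Tm _; have := block_weight Tm; move: (weight _ _ _ _ _) (n ^ p) => w Q hw.
have : m * w <= m * (2 * Q) by rewrite leq_mul2l hw orbT.
by lia.
Qed.

Lemma block_vertices_bound : m + m + inner_vertices gs <= 6 * (m * (n ^ p * p)).
Proof.
have h := inner_bound; have : m <= m * (n ^ p * p); last by lia.
by rewrite leq_pmulr // muln_gt0 expn_gt0; lia.
Qed.

Lemma block_edges_bound : size (edges m (m + m) gs) <= 5 * (m * (n ^ p * p)).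
Proof.
rewrite size_edges; have h := inner_bound; have h2 := sum_widths (leqnn m).
have h3 := leq_mul rank_p (leqnn (m * m)).
have : p * (m * m) <= m * (n ^ p * p); last by rewrite -/gs in h2; lia.
have := @leq_expn_self n p ltac:(lia); have mn : m <= n by lia.
move: (n ^ p) => Q hQ; have mQ : m <= Q by lia.
have := leq_mul (leqnn (p * m)) mQ; lia.
Qed.

Lemma block_time_bound : cluster_time n d i0 m <= 1200 * (m * (n ^ p * p)).
Proof.
rewrite /cluster_time; set Q := n ^ p.
pose big T := m * (100 * (n + weight n d i0 m T + m + 2) + 11) + 40 * n + 100.
pose c := m * (100 * (n + 2 * Q + m + 2) + 11) + 40 * n + 100.
have : \sum_(T < m) (task_time n m (class_end d i0 m T) (weight n d i0 m T) + 11) <= 111 * m + p * c.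
  apply: leq_trans (_ : \sum_(T < m) (111 + (if class_end d i0 m T then big T else 0)) <= _).
    by apply: leq_sum => T _; rewrite /task_time /big; case: ifP => _; lia.
  rewrite big_split /= sum_nat_const card_ord mulnC leq_add2l.
  apply: leq_trans (leq_mul rank_p (leqnn c)).
  apply: (@class_gadgets_bound m c) => // T Tm _; rewrite /big /c !leq_add2r leq_mul2l; apply/orP; right.
  have := block_weight Tm; rewrite -/Q; lia.
have nQ : n <= Q by apply: leq_expn_self; lia.
have mn : m <= n by lia.
have Q0 : 0 < Q by lia.
have p0 : 0 < p by lia.
(* Every monomial of [c] is at most its coefficient times m Q, and the coefficients sum to 751. With
   the terms 111 m and 150 the total stays below 1200. *)
have cm : c <= 850 * (m * Q).
  have h1 : m * n <= m * Q by rewrite leq_mul2l nQ orbT.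
  have h2 : m * m <= m * Q by rewrite leq_mul2l (leq_trans mn nQ) orbT.
  have h3 : Q <= m * Q by rewrite leq_pmull.
  have h4 : m <= m * Q by rewrite leq_pmulr.
  by rewrite /c; lia.
have h5 : p * c <= p * (850 * (m * Q)) by rewrite leq_mul2l cm orbT.
have h6 : m <= m * (Q * p) by rewrite leq_pmulr // muln_gt0 Q0.
have h7 : 0 < m * (Q * p) by rewrite !muln_gt0 m_gt0 Q0.
move: (\sum_(_ < _) _) => t; lia.
Qed.

End Bounds.

(** The blocks tile the slots, so the costs of the clusters add up to n times the cost per slot. *)
Lemma sum_block_sizes al n k :
  \sum_(j < k) (if block_end al n j then j.+1 - block_start al n j else 0) = block_start al n k.
Proof.
elim: k => [|k IH]; first by rewrite big_ord0.
rewrite big_ord_recr /= IH; case: ifP => _; last by rewrite addn0.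
by have := block_start_le al n k; lia.
Qed.

Theorem theorem9 :
  exists (P : cmd) (c : nat),
  forall D : seq nat, is_instance D ->
  let n := size D in
  let p := max_distinct D in
  exists (inst : nat * nat -> em_instance) (code : nat * nat -> seq nat),
  [/\ computes_in P D (c * (n ^ p.+1 * p))
        (flatten [seq code C | C <- clusters D]),
      forall C, C \in clusters D ->
        [/\ em_code (inst C) (code C),
            em_nv (inst C) <= c * (n ^ p.+1 * p)
          & #|em_edges (inst C)| <= c * (n ^ p.+1 * p)]
    & two_visits D <-> (forall C, C \in clusters D -> exact_matching (inst C))].
Proof.
(* In units of n^(p + 1) p, the clusters cost 1200 and the sum of all time bounds is at most
   1611. *)
exists main_cmd, 2000 => D D_inst n p.
set d := nth 0 (sorted_deadlines D); set al := alpha d n.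
have n_gt0 : 0 < n := inst_n_gt0 D_inst.
have d_gt0 : forall i, i < n -> 0 < d i := inst_d_gt0 D_inst.
have d_mono : forall i j, i <= j < n -> d i <= d j by move=> i j; apply: inst_d_mono.
have clE : clusters D = [seq (block_start al n j, j) | j <- iota 0 n & block_end al n j].
  exact: clustersE.
have inC j : j < n -> block_end al n j -> (block_start al n j, j) \in clusters D.
  by move=> jn bj; rewrite clE; apply: map_f; rewrite mem_filter bj mem_iota.
have start_le j : block_start al n j <= j by exact: block_start_le.
have rank_le j : j < n -> block_end al n j ->
    class_rank d (block_start al n j) (j.+1 - block_start al n j) (j.+1 - block_start al n j) <= p.
  move=> jn bj; have sj := start_le j.
  apply: leq_trans (@class_rank_undup d n _ _ n_gt0 _ _ d_mono) _; try lia.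
  rewrite -(cluster_deadlinesE D_inst); last by rewrite sj.
  exact: (@leq_bigmax_seq _ _ xpredT (fun C => size (undup (cluster_deadlines D C))) _ (inC j jn bj)).
have p_bound : 0 < p <= n.
  apply/andP; split.
    have bl : block_end al n n.-1 by apply: block_end_last.
    have sj := start_le n.-1.
    apply: leq_trans (rank_le n.-1 _ bl); last by lia.
    have := @class_rank_lt d n (block_start al n n.-1) (n.-1.+1 - block_start al n n.-1) n_gt0 _ _ 0.
    by move=> /(_ ltac:(lia) ltac:(lia) ltac:(lia)); lia.
  apply/bigmax_leqP_seq => C; rewrite clE => /mapP [j]; rewrite mem_filter mem_iota => /andP [bj jn] -> _.
  apply: leq_trans (size_undup _) _.
  rewrite (cluster_deadlinesE D_inst); last by have := start_le j; rewrite -/n; lia.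
  by rewrite size_mkseq; lia.
set Q := n ^ p; have nQ : n <= Q by apply: leq_expn_self; lia.
have Qn : n ^ p.+1 * p = n * (Q * p) by rewrite expnS mulnA.
pose inst (C : nat * nat) := local_instance d n C.1 (C.2.+1 - C.1).
pose code (C : nat * nat) := cluster_word n al d C.1 (C.2.+1 - C.1).
have inP C : C \in clusters D -> exists j, [/\ j < n, block_end al n j & C = (block_start al n j, j)].
  by rewrite clE => /mapP [j]; rewrite mem_filter mem_iota => /andP [bj jn] ->; exists j.
exists inst, code; split.
- have -> : flatten [seq code C | C <- clusters D] = block_words n al d n.
    by rewrite clE -map_comp.
  have [t [s [ex le out]]] := computes_main n_gt0.
  exists t, s; split=> //; apply: leq_trans le _; rewrite -/n -/d -/al.
  have : \sum_(j < n) (block_time n al d j + 41) <= 1200 * (n * (Q * p)) + 41 * n.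
    rewrite big_split /= sum_nat_const card_ord (mulnC n 41) leq_add2r.
      apply: leq_trans (_ : \sum_(j < n) (if block_end al n j then j.+1 - block_start al n j else 0) *
                               (1200 * (Q * p)) <= _).
        apply: leq_sum => j _; rewrite /block_time; case: ifP => // bj.
        have sj := start_le j; have jn := ltn_ord j.
        have := @block_time_bound d n (block_start al n j) (j.+1 - block_start al n j) p.
        move=> /(_ ltac:(lia) ltac:(lia) p_bound (rank_le j jn bj)); rewrite -/Q; lia.
      rewrite -big_distrl /= sum_block_sizes.
      have h : block_start al n n * (1200 * (Q * p)) <= n * (1200 * (Q * p)).
        by rewrite leq_mul2r start_le orbT.
      by lia.
  have p0 : 0 < p by lia.
  (* The quadratic time for sorting is absorbed because p is at least 1. *)
  have h1 : n * n <= n * (Q * p) by rewrite leq_mul2l (leq_trans nQ (leq_pmulr _ p0)) orbT.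
  have h2 : 0 < n * n by rewrite muln_gt0 n_gt0.
  have h3 : n <= n * n by rewrite leq_pmulr.
  rewrite Qn; move: (\sum_(_ < _) _) => tt; lia.
- move=> C /inP [j [jn bj ->]]; have sj := start_le j.
  set i0 := block_start al n j; set m := j.+1 - i0.
  have m_gt0 : 0 < m by rewrite /m; lia.
  have mn : i0 + m <= n by rewrite /m; lia.
  have rp : class_rank d i0 m m <= p by apply: rank_le.
  have simple := es_simple (@gadgets_ok d n i0 m).
  have nv0 : 0 < m + m + inner_vertices (gadgets n al d i0 m m) by lia.
  have k0 : 0 < red_target n d i0 m m by apply: red_target_gt0.
  have le : m * (Q * p) <= n ^ p.+1 * p by rewrite Qn leq_mul2r; apply/orP; right; lia.
  split; first exact: list_instance_code nv0 k0 simple.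
    rewrite /= prednK //.
    apply: leq_trans (@block_vertices_bound d n i0 m p m_gt0 mn p_bound rp) _.
    exact: leq_mul.
  rewrite /= (card_list_edges nv0 k0 simple).
  apply: leq_trans (@block_edges_bound d n i0 m p m_gt0 mn p_bound rp) _.
  exact: leq_mul.
have dE : mkseq d n = sorted_deadlines D by rewrite /n -(size_sort leq D) mkseq_nth.
split=> [tv C /inP [j [jn bj ->]]|em].
  have [f [g V]] := two_visits_visits tv.
  have perm : perm_eq (mkseq d n) (mkseq (nth 0 D) n).
    by rewrite mkseq_nth dE perm_sort.
  have [f' [g' V']] := visits_perm perm V.
  have [f2 [g2 [V2 onto]]] := visits_first_slots n_gt0 d_gt0 d_mono V'.
  have [x px plx] := visits_placeable n_gt0 d_gt0 V2 onto.
  have sj := start_le j.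
  apply: local_matching => //=; try lia.
  exact: (@placeable_local d n n_gt0 d_gt0 d_mono x j px plx jn bj).
have [|x px plx] := @local_placeable d n n_gt0.
  move=> j jn bj; have sj := start_le j; apply: matching_local => //; try by rewrite -/al; lia.
  exact: em (inC j jn bj).
have [f [g V]] := placeable_visits n_gt0 d_gt0 px plx.
have perm : perm_eq (mkseq (nth 0 D) n) (mkseq d n).
  by rewrite mkseq_nth dE perm_sym perm_sort.
have [f' [g' V']] := visits_perm perm V.
exact: visits_two_visits V'.
Qed.
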